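(* Let $P$ be a finite poset with $n\ge1$ elements. The number of zigzag labelings of $P$ equals $(n-1)!\,\mathrm{MaxOne}(\widetilde{K}_P(\mathbf{x}))$.
   Context: $K_P(\mathbf{x})=\sum_\theta x_1^{|\theta^{-1}(1)|}x_2^{|\theta^{-1}(2)|}\cdots$, summed over all order-preserving maps $\theta\colon P\to\mathbb{Z}^+$. Quasisymmetric power sums: for a composition $\alpha=(\alpha_1,\dots,\alpha_l)$ let $\pi(\alpha)=\prod_{i=1}^{l}(\alpha_1+\cdots+\alpha_i)$; if $\alpha$ refines $\beta$, let $\alpha^{(i)}$ be the parts of $\alpha$ summing to $\beta_i$ and $\pi(\alpha,\beta)=\prod_i\pi(\alpha^{(i)})$; $\psi_\alpha=\sum_{\beta\text{ coarsens }\alpha}\frac{1}{\pi(\alpha,\beta)}M_\beta$ where $M_\beta$ are monomial quasisymmetric functions; the $\psi_\alpha$ form a basis of $\mathrm{QSym}$. $\widetilde{K}_P(\mathbf{x})$ is the sum of those terms $c_\alpha\psi_\alpha$ in the $\psi$-expansion of $K_P(\mathbf{x})$ for which $l(\alpha)$ equals the minimum length of a composition with nonzero coefficient. $\mathrm{MaxOne}$ is the linear functional on $\mathrm{QSym}$ with $\mathrm{MaxOne}(L_\alpha)=(-1)^k$ if $\alpha=(n-k,1^k)$ for some $0\le k<n$ and $0$ otherwise, where $L_\alpha=\sum_{\beta\text{ refines }\alpha}M_\beta$. A zigzag labeling of $P$ is a bijection $\phi\colon P\to[n]$ such that (1) if $x$ is minimal and $\phi(x)\ne1$ then there is $y\succ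 x$ with $\phi(y)<\phi(x)$, and (2) if $x$ is not minimal then there is a minimal element $y\prec x$ with $\phi(y)<\phi(x)$. *)

(* Defs.v *)
From HB Require Import structures.
From mathcomp Require Import all_boot all_order all_algebra finmap.
From mathcomp Require Import boolp classical_sets functions cardinality fsbigop.

Set Implicit Arguments.
Unset Strict Implicit.
Unset Printing Implicit Defensive.

Import Order.TTheory GRing.Theory Num.Theory.
Local Open Scope classical_set_scope.
Local Open Scope ring_scope.

Record composition := Composition {
  parts :> seq nat;
  partsP : all (leq 1) parts
}.
HB.instance Definition _ := [isSub for parts].
HB.instance Definition _ := [Countable of composition by <:].

Definition is_blocks (a b : seq nat) (g : seq (seq nat)) : Prop :=
  flatten g = a /\ map sumn g = b.

Definition refines (a b : composition) : Prop := exists g, is_blocks a b g.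

(* The blocks alpha^(1), alpha^(2), ... of [a] summing to the parts of [b]; they
   are unique (lemma [blocks_eq]). *)
Definition blocks (a b : composition) : seq (seq nat) :=
  xget [::] [set g | is_blocks a b g].

Definition pi_comp (a : seq nat) : nat :=
  (\prod_(i < size a) sumn (take i.+1 a))%N.

Definition pi_ref (a b : composition) : nat :=
  (\prod_(g <- blocks a b) pi_comp g)%N.

(* Exponent vectors of monomials. The index set Z^+ of the variables is
   represented by [nat]: index [i] stands for x_(i+1). *)
Definition monom := {fsfun nat -> nat with 0%N}.

(* Formal power series in x_1, x_2, ..., as the function giving the coefficient
   of each monomial. *)
Definition power_series := monom -> rat.
HB.instance Definition _ := GRing.Lmodule.copy power_series (monom -> rat^o).

(* The nonzero exponents, in increasing order of the variables. *)
Definition exponents (m : monom) : seq nat :=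
  [seq m i | i <- sort leq (finsupp m)].

Definition mdeg (m : monom) : nat := sumn (exponents m).

Definition quasisymmetric (F : power_series) : Prop :=
  (forall m m' : monom, exponents m = exponents m' -> F m = F m') /\
  (exists N, forall m, F m != 0 -> (mdeg m <= N)%N).

(* A monomial occurs in M_b, with coefficient 1, iff it is
   x_(i_1)^(b_1) ... x_(i_l)^(b_l) for some i_1 < ... < i_l. *)
Definition Mqs (b : composition) : power_series :=
  fun m => (exponents m == b)%:R.

Definition Lqs (a : composition) : power_series :=
  \sum_(b \in [set b | refines b a]) Mqs b.

Definition psi (a : composition) : power_series :=
  \sum_(b \in [set b | refines a b]) (pi_ref a b)%:R^-1 *: Mqs b.

Definition coefs := {fsfun composition -> rat with 0}.

Definition is_expansion (B : composition -> power_series) (F : power_series)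
    (c : coefs) : Prop :=
  F = \sum_(a <- finsupp c) c a *: B a.

(* The coefficients of [F] in the family [B]. Expansions in the [psi] and in the
   [Lqs] exist and are unique for quasisymmetric [F], in particular for [K P]:
   lemmas [psi_expansionP], [psi_coordE], [L_expansionP], [L_coordE] and
   [K_quasisymmetric]. *)
Definition coord (B : composition -> power_series) (F : power_series) : coefs :=
  xget [fsfun] [set c | is_expansion B F c].

Definition MaxOne_hook (a : composition) : rat :=
  let n := sumn a in
  if [pick k : 'I_n | parts a == (n - k)%N :: nseq k 1%N] is Some k
  then (-1) ^+ k else 0.

(* Linear on quasisymmetric functions, with the prescribed values on the [Lqs]:
   lemmas [MaxOne_linear] and [MaxOne_L]. *)
Definition MaxOne (F : power_series) : rat :=
  let c := coord Lqs F in \sum_(a <- finsupp c) c a * MaxOne_hook a.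

Section Posets.
Variables (d : Order.disp_t) (P : finPOrderType d).

Definition order_preserving (t : P -> nat) : Prop :=
  {homo t : x y / (x <= y)%O >-> (x <= y)%N}.

Definition weight (t : P -> nat) : monom :=
  [fsfun i in [fset t x | x : P]%fset => #|[set x | t x == i]%SET| | 0%N].

Definition K : power_series :=
  fun m => \sum_(t \in [set t : {ffun P -> nat} | order_preserving t])
    ((weight t == m)%:R : rat).

Definition Ktilde : power_series :=
  let c := coord psi K in
  \sum_(a <- finsupp c | all (fun b : composition => size a <= size b)%N
                             (finsupp c))
    c a *: psi a.

Definition minimal (x : P) : Prop := forall y : P, ~ (y < x)%O.

(* The label k in [n] is represented by the ordinal k - 1. *)
Definition zigzag (f : P -> 'I_#|P|) : Prop :=
  [/\ bijective f,
      forall x, minimal x -> val (f x) <> 0%N ->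
        exists y, (x < y)%O /\ (f y < f x)%N
    & forall x, ~ minimal x ->
        exists y, [/\ minimal y, (y < x)%O & (f y < f x)%N]].

Definition zigzag_labelings : {set {ffun P -> 'I_#|P|}} :=
  [set f : {ffun P -> 'I_#|P|} | `[< zigzag f >]]%SET.

End Posets.

Lemma ps_addE (F G : power_series) m : (F + G) m = F m + G m.
Proof. by []. Qed.

Lemma ps_scaleE (x : rat) (F : power_series) m : (x *: F) m = x * F m.
Proof. by []. Qed.

Lemma ps_sumE I (r : seq I) (p : pred I) (F : I -> power_series) m :
  (\sum_(i <- r | p i) F i) m = \sum_(i <- r | p i) F i m.
Proof. by elim/big_rec2: _ => //= i y ? pi <-. Qed.

Lemma is_blocks_sumn a b g : is_blocks a b g -> sumn a = sumn b.
Proof. by case=> <- <-; rewrite sumn_flatten. Qed.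

Lemma is_blocks_size a b g : all (leq 1) b -> is_blocks a b g ->
  (size b <= size a)%N /\ (size a = size b -> a = b).
Proof.
move=> bP [<- gb]; move: bP; rewrite -{b}gb; elim: g => [//|h g IH]; rewrite /= => /andP[h0 gP].
have [le eqg] := IH gP.
move: h0; case: h => [|x h] //= _.
rewrite size_cat ltnS; split; first by apply: leq_trans le (leq_addl _ _).
case: h => [|y h] /=; first by rewrite add0n addn0 => -[] /eqg ->.
by move=> [e]; move: le; rewrite -e addSn ltnNge leq_addl.
Qed.

Lemma sumn_pos_eq0 s : all (leq 1) s -> sumn s = 0%N -> s = [::].
Proof. by case: s => [|[|x] s]. Qed.

Lemma is_blocks_uniq a b g g' : all (leq 1) a -> all (leq 1) b ->
  is_blocks a b g -> is_blocks a b g' -> g = g'.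
Proof.
move=> aP bP [ga gb] []; move: aP bP; rewrite -{a}ga -{b}gb; elim: g g' => [|h g IH] [|h' g'] //= aP /andP[_ bP].
move=> e [eh eg].
have hh : h' = h.
  have e1 : take (size h) (h' ++ flatten g') = h by rewrite e take_size_cat.
  have e2 : take (size h') (h ++ flatten g) = h' by rewrite -e take_size_cat.
  have [le|/ltnW le] := leqP (size h) (size h').
    move: e1; rewrite takel_cat // => e1.
    have e3 := cat_take_drop (size h) h'; rewrite e1 in e3.
    move: aP; rewrite -e -e3 -catA !all_cat => /and3P[_ dP _].
    have d0 : drop (size h) h' = [::].
      apply: sumn_pos_eq0 dP _; move: eh; rewrite -{1}e3 sumn_cat.
      by move/eqP; rewrite -{2}[sumn h]addn0 eqn_add2l => /eqP.
    by move: e3; rewrite d0 cats0 => ->.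
  move: e2; rewrite takel_cat // => e2.
  have e3 := cat_take_drop (size h') h; rewrite e2 in e3.
  move: aP; rewrite -e3 -catA !all_cat => /and3P[_ dP _].
  have d0 : drop (size h') h = [::].
    apply: sumn_pos_eq0 dP _; move: eh; rewrite -{1}e3 sumn_cat.
    by move/esym/eqP; rewrite -{2}[sumn h']addn0 eqn_add2l => /eqP.
  by move: e3; rewrite d0 cats0 => ->.
rewrite hh in e *; congr cons.
move: aP; rewrite all_cat => /andP[_ aP].
apply: IH => //; move/eqP: e; rewrite eqseq_cat // eqxx => /eqP //.
Qed.

Lemma blocks_eq (a b : composition) g : is_blocks a b g -> blocks a b = g.
Proof.
move=> gP; apply: (@is_blocks_uniq a b) (partsP a) (partsP b) _ (gP).
exact: (xgetPex [::] (P := [set g | is_blocks a b g]) (ex_intro _ g gP)).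
Qed.

Lemma refines_refl a : refines a a.
Proof.
exists [seq [:: x] | x <- a]; split; first by rewrite flatten_seq1.
rewrite -map_comp -[RHS]map_id; apply: eq_map => x /=; exact: addn0.
Qed.

Lemma refines_sumn (a b : composition) : refines a b -> sumn a = sumn b.
Proof. by case=> g /is_blocks_sumn. Qed.

Lemma refines_size (a b : composition) :
  refines a b -> (size b <= size a)%N.
Proof. by case=> g /(is_blocks_size (partsP b))[]. Qed.

Lemma refines_size_eq (a b : composition) :
  refines a b -> size a = size b -> a = b.
Proof. by case=> g /(is_blocks_size (partsP b))[_ h] /h/val_inj. Qed.

Lemma pi_comp_gt0 s : all (leq 1) s -> (0 < pi_comp s)%N.
Proof.
move=> sP; apply: prodn_cond_gt0 => i _; case: s i sP => [[]//|x s] i.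
by rewrite /= => /andP[x0 _]; rewrite addn_gt0 x0.
Qed.

Lemma pi_ref_gt0 (a b : composition) : refines a b -> (0 < pi_ref a b)%N.
Proof.
move=> [g gP]; rewrite /pi_ref (blocks_eq gP); case: gP => ga _.
rewrite big_seq; apply: prodn_cond_gt0 => h hg; apply: pi_comp_gt0.
by apply/allP => x xh; apply: (allP (partsP a)); rewrite -ga; apply/flattenP; exists h.
Qed.

Lemma finite_sumn_le N : finite_set [set a : composition | (sumn a <= N)%N].
Proof.
pose fix S k : seq (seq nat) :=
  if k is k'.+1 then [::] :: [seq x :: s | x <- iota 0 N.+1, s <- S k'] else [:: [::]].
have SP k s : (size s <= k)%N -> all (fun x => x <= N)%N s -> s \in S k.
  elim: k s => [|k IH] [|x s] // sk /andP[xN sN].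
  rewrite inE; apply/orP; right; apply/allpairsP; exists (x, s); split => //.
    by rewrite mem_iota add0n ltnS.
  exact: IH.
apply: (@sub_finite_set _ _ [set` (pmap insub (S N) : seq composition)]) => //.
move=> a /= aN; rewrite mem_pmap_sub; apply: SP.
  apply: leq_trans aN; case: a => s /= sP; elim: s sP => //= x s IH /andP[x0 sP].
  by rewrite -add1n leq_add // IH.
apply/allP => x xa; apply: leq_trans aN; move: xa; case: a => s _ /=.
elim: s => //= y s IH; rewrite inE => /predU1P[->|/IH h]; rewrite ?leq_addr //.
exact: leq_trans h (leq_addl _ _).
Qed.

Lemma exponents_pos m : all (leq 1) (exponents m).
Proof.
by apply/allP => x /mapP[i]; rewrite mem_sort mem_finsupp => ? ->; rewrite lt0n.
Qed.

Definition mcomp (m : monom) : composition := Composition (exponents_pos m).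

(* The monomial x_1^(a_1) ... x_l^(a_l). *)
Definition mon (a : composition) : monom :=
  [fsfun i in [fset i | i in iota 0 (size a)]%fset => nth 0%N a i | 0%N].

Lemma monE (a : composition) i : mon a i = nth 0%N a i.
Proof.
rewrite /mon fsfunE in_fset /= mem_iota /= add0n; case: ltnP => // h.
by rewrite nth_default.
Qed.

Lemma exponents_mon (a : composition) : exponents (mon a) = a.
Proof.
rewrite /exponents.
have -> : sort leq (finsupp (mon a)) = iota 0 (size a).
  apply: (sorted_eq leq_trans anti_leq).
  - exact: sort_sorted leq_total _.
  - exact: iota_sorted.
  rewrite perm_sort; apply: uniq_perm; rewrite ?fset_uniq ?iota_uniq // => i.
  rewrite mem_finsupp monE mem_iota /= add0n; case: ltnP => h.
    by rewrite -lt0n; apply: (allP (partsP a)); rewrite mem_nth.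
  by rewrite nth_default.
rewrite -[RHS](mkseq_nth 0%N) /mkseq; apply: eq_map => i; exact: monE.
Qed.

Lemma mcomp_mon a : mcomp (mon a) = a.
Proof. by apply: val_inj; rewrite /= exponents_mon. Qed.

Lemma MqsE b m : Mqs b m = (mcomp m == b)%:R.
Proof. by []. Qed.

Lemma sum_MqsE (U : {fset composition}) (w : composition -> rat) m :
  (\sum_(b <- U) w b *: Mqs b) m = if mcomp m \in U then w (mcomp m) else 0.
Proof.
rewrite ps_sumE; case: ifP => h.
  rewrite (big_fsetD1 _ h) /= ps_scaleE MqsE eqxx mulr1 big1_seq ?addr0 // => b.
  rewrite !inE /= => /andP[nb _].
  by rewrite ps_scaleE MqsE eq_sym (negPf nb) mulr0.
rewrite big1_seq // => b /= bU; rewrite ps_scaleE MqsE.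
by rewrite (_ : mcomp m == b = false) ?mulr0 //; apply: contraFF h => /eqP->.
Qed.

Lemma fsum_MqsE (A : set composition) (w : composition -> rat) m : finite_set A ->
  (\sum_(b \in A) w b *: Mqs b) m = if mcomp m \in A then w (mcomp m) else 0.
Proof. by move=> fA; rewrite fsbig_finite //= sum_MqsE in_fset_set. Qed.

Lemma finite_coarsenings a : finite_set [set b | refines a b].
Proof.
apply: sub_finite_set (finite_sumn_le (sumn a)) => b /= /refines_sumn ->.
exact: leqnn.
Qed.

Lemma finite_refinements a : finite_set [set b | refines b a].
Proof.
apply: sub_finite_set (finite_sumn_le (sumn a)) => b /= /refines_sumn ->.
exact: leqnn.
Qed.

Lemma LqsE a m : Lqs a m = (`[< refines (mcomp m) a >])%:R.
Proof.
rewrite /Lqs (eq_fsbigr (fun b => 1 *: Mqs b)); last by move=> b _; rewrite scale1r.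
rewrite fsum_MqsE; last exact: finite_refinements.
case: asboolP => [h|h]; first by rewrite ifT // inE.
by rewrite ifF //; apply/negP; rewrite inE.
Qed.

Lemma psiE a m :
  psi a m = if `[< refines a (mcomp m) >] then (pi_ref a (mcomp m))%:R^-1 else 0.
Proof.
rewrite /psi fsum_MqsE; last exact: finite_coarsenings.
case: asboolP => [h|h]; first by rewrite ifT // inE.
by rewrite ifF //; apply/negP; rewrite inE.
Qed.

Section Triangular.
Variables (B : composition -> power_series) (rank : composition -> nat).
Hypothesis Binv : forall a m m', exponents m = exponents m' -> B a m = B a m'.
Hypothesis Bdiag : forall a, B a (mon a) != 0.
Hypothesis Btrig : forall a b, B a (mon b) != 0 -> b != a -> (rank b < rank a)%N.
Hypothesis Bdeg : forall a b, B a (mon b) != 0 -> sumn b = sumn a.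

Lemma triangular_uniq F c c' : is_expansion B F c -> is_expansion B F c' -> c = c'.
Proof.
rewrite /is_expansion => Fc Fc'.
pose U := (finsupp c `|` finsupp c')%fset.
have wide (e : coefs) : {subset finsupp e <= U} ->
    \sum_(a <- finsupp e) e a *: B a = \sum_(a <- U) e a *: B a.
  move=> /fsubsetP eU; apply: (big_fset_incl _ eU) => a _ ae.
  by rewrite fsfun_dflt // scale0r.
have z : \sum_(a <- U) (c a - c' a) *: B a = 0.
  under eq_bigr do rewrite scalerBl.
  rewrite sumrB -!wide -?Fc -?Fc' ?subrr // => a ae; rewrite inE ae ?orbT //.
pose s := [seq a <- U | c a != c' a].
have smax (r : seq composition) : r != [::] ->
    exists2 a, a \in r & forall b, b \in r -> (rank b <= rank a)%N.
  elim: r => // x [|y r] IH _; first by exists x; rewrite ?inE // => b; rewrite inE => /eqP->.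
  have [//|a ar amax] := IH _; have [le|lt] := leqP (rank x) (rank a).
    exists a; first by rewrite inE ar orbT.
    by move=> b; rewrite inE => /predU1P[->|/amax].
  exists x; first by rewrite inE eqxx.
  by move=> b; rewrite inE => /predU1P[->//|/amax/leq_trans]; apply; apply: ltnW.
have [s0|/smax[a]] := eqVneq s [::].
  apply/fsfunP => a; have [aU|] := boolP (a \in U).
    apply/eqP/negPn/negP => ne.
    by have : a \in s by [rewrite mem_filter ne]; rewrite s0.
  by rewrite inE negb_or => /andP[? ?]; rewrite !fsfun_dflt.
rewrite mem_filter => /andP[ne aU] amax.
have /(congr1 (fun G : power_series => G (mon a))) := z.
rewrite ps_sumE (big_fsetD1 _ aU) /= ps_scaleE big1_seq ?addr0.
  by move/eqP; rewrite mulf_eq0 (negPf (Bdiag a)) orbF subr_eq0 (negPf ne).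
move=> b /=; rewrite !inE -/U => /andP[nb bU]; rewrite ps_scaleE.
have [->|nc] := eqVneq (c b) (c' b); first by rewrite subrr mul0r.
have [->|nB] := eqVneq (B b (mon a)) 0; first by rewrite mulr0.
have := Btrig nB; rewrite eq_sym => /(_ nb); rewrite ltnNge amax //.
by rewrite mem_filter nc inE bU.
Qed.

Definition in_span (F : power_series) : Prop :=
  exists s : seq (rat * composition), F = \sum_(p <- s) p.1 *: B p.2.

Lemma in_spanD F G : in_span F -> in_span G -> in_span (F + G).
Proof. by move=> [s ->] [t ->]; exists (s ++ t); rewrite big_cat. Qed.

Lemma in_spanZ x F : in_span F -> in_span (x *: F).
Proof.
move=> [s ->]; exists [seq (x * p.1, p.2) | p <- s].
by rewrite scaler_sumr big_map; apply: eq_bigr => p _; rewrite scalerA.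
Qed.

Lemma in_span0 : in_span 0.
Proof. by exists [::]; rewrite big_nil. Qed.

Lemma in_span_sum (r : seq composition) (F : composition -> power_series) :
  (forall i, i \in r -> in_span (F i)) -> in_span (\sum_(i <- r) F i).
Proof.
move=> FP; rewrite big_seq; apply: big_ind => //; first exact: in_span0.
exact: in_spanD.
Qed.

Lemma in_span_expansion F : in_span F -> exists c, is_expansion B F c.
Proof.
move=> [s ->]; pose U := [fset p.2 | p in s]%fset.
pose w a : rat := \sum_(p <- s | p.2 == a) p.1.
pose c : coefs := [fsfun a in U => w a | 0].
exists c; rewrite /is_expansion.
have -> : \sum_(a <- finsupp c) c a *: B a = \sum_(a <- U) w a *: B a.
  have sub : (finsupp c `<=` U)%fset.
    by apply/fsubsetP => a; rewrite mem_finsupp fsfunE; case: ifP; rewrite ?eqxx.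
  rewrite (big_fset_incl _ sub) //=; last by move=> a _ ?; rewrite fsfun_dflt ?scale0r.
  by rewrite big_seq [RHS]big_seq; apply: eq_bigr => a aU; rewrite fsfunE aU.
under [RHS]eq_bigr do rewrite scaler_suml.
rewrite (exchange_big_dep xpredT) //= big_seq [RHS]big_seq; apply: eq_bigr => p ps.
have pU : p.2 \in U by apply/imfsetP; exists p.
rewrite big_mkcond /= (big_fsetD1 _ pU) /= eqxx big1_seq ?addr0 // => a.
by rewrite /= !inE eq_sym => /andP[/negPf->].
Qed.

Lemma M_sum (U : {fset composition}) (F : power_series) :
  (forall m m', exponents m = exponents m' -> F m = F m') ->
  (forall b, F (mon b) != 0 -> b \in U) ->
  F = \sum_(b <- U) F (mon b) *: Mqs b.
Proof.
move=> Finv FU; apply/funext => m; rewrite (sum_MqsE U (fun b => F (mon b))).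
have Fm : F m = F (mon (mcomp m)) by apply: Finv; rewrite exponents_mon.
case: ifP => // /negbT; rewrite Fm; apply: contraNeq; exact: FU.
Qed.

Lemma M_in_span a : in_span (Mqs a).
Proof.
have [k] := ubnP (rank a); elim: k a => // k IH a; rewrite ltnS => ak.
pose U := fset_set [set b : composition | (sumn b <= sumn a)%N].
have UP b : (b \in U) = (sumn b <= sumn a)%N.
  rewrite in_fset_set; last exact: finite_sumn_le.
  by apply/idP/idP; rewrite inE.
have e : B a = \sum_(b <- U) B a (mon b) *: Mqs b.
  by apply: M_sum (@Binv a) _ => b /Bdeg e; rewrite UP e.
have aU : a \in U by rewrite UP.
rewrite (big_fsetD1 _ aU) /= in e.
have {e} -> : Mqs a = (B a (mon a))^-1 *:
    (B a + (-1) *: \sum_(b <- (U `\ a)%fset) B a (mon b) *: Mqs b).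
  by rewrite scaleN1r {2}e addrK scalerA mulVf ?Bdiag // scale1r.
apply/in_spanZ/in_spanD; first by exists [:: (1, a)]; rewrite big_seq1 scale1r.
apply/in_spanZ/in_span_sum => b; rewrite !inE => /andP[nb _].
have [->|nB] := eqVneq (B a (mon b)) 0; first by rewrite scale0r; apply: in_span0.
by apply/in_spanZ/IH; apply: leq_trans ak; apply: Btrig.
Qed.

Lemma triangular_exp F : quasisymmetric F -> exists c, is_expansion B F c.
Proof.
move=> [Finv [N FN]]; apply: in_span_expansion.
rewrite (M_sum (U := fset_set [set b : composition | (sumn b <= N)%N]) Finv).
  by apply: in_span_sum => b _; apply/in_spanZ/M_in_span.
move=> b /FN; rewrite /mdeg exponents_mon in_fset_set ?inE //.
exact: finite_sumn_le.
Qed.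

Lemma triangular_coordP F : quasisymmetric F -> is_expansion B F (coord B F).
Proof. by move=> /triangular_exp; apply: xgetPex. Qed.

Lemma triangular_coordE F c : is_expansion B F c -> coord B F = c.
Proof.
move=> Fc; apply: (@triangular_uniq F) => //.
by apply: (xgetPex _ (ex_intro _ c Fc : exists c, [set c | is_expansion B F c] c)).
Qed.

End Triangular.

Lemma psi_inv a m m' : exponents m = exponents m' -> psi a m = psi a m'.
Proof.
move=> e; rewrite !psiE (_ : mcomp m = mcomp m') //; exact: val_inj.
Qed.

Lemma L_inv a m m' : exponents m = exponents m' -> Lqs a m = Lqs a m'.
Proof.
move=> e; rewrite !LqsE (_ : mcomp m = mcomp m') //; exact: val_inj.
Qed.

Lemma psi_mon a b : psi a (mon b) != 0 <-> refines a b.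
Proof.
rewrite psiE mcomp_mon; split; first by case: asboolP; rewrite ?eqxx.
by move=> ab; rewrite asboolT // invr_eq0 pnatr_eq0 -lt0n pi_ref_gt0.
Qed.

Lemma L_mon a b : Lqs a (mon b) != 0 <-> refines b a.
Proof.
rewrite LqsE mcomp_mon; split; first by case: asboolP; rewrite ?eqxx.
by move=> ab; rewrite asboolT // oner_eq0.
Qed.

Lemma size_le_sumn (a : composition) : (size a <= sumn a)%N.
Proof.
case: a => s /= sP; elim: s sP => //= x s IH /andP[x0 sP].
by rewrite -add1n leq_add // IH.
Qed.

Lemma psi_diag a : psi a (mon a) != 0.
Proof. exact/psi_mon/refines_refl. Qed.

Lemma psi_trig (a b : composition) :
  psi a (mon b) != 0 -> b != a -> (size b < size a)%N.
Proof.
move=> /psi_mon ab ne; rewrite ltn_neqAle refines_size // andbT.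
apply: contra ne => /eqP e; apply/eqP/esym; exact: refines_size_eq ab (esym e).
Qed.

Lemma psi_deg (a b : composition) : psi a (mon b) != 0 -> sumn b = sumn a.
Proof. by move=> /psi_mon/refines_sumn. Qed.

Lemma L_diag a : Lqs a (mon a) != 0.
Proof. exact/L_mon/refines_refl. Qed.

Lemma L_trig (a b : composition) :
  Lqs a (mon b) != 0 -> b != a -> (sumn b - size b < sumn a - size a)%N.
Proof.
move=> /L_mon ba ne; rewrite (refines_sumn ba) ltn_sub2l //; last first.
  rewrite ltn_neqAle refines_size // andbT eq_sym.
  by apply: contra ne => /eqP e; apply/eqP; apply: refines_size_eq ba e.
have lt : (size a < size b)%N.
  rewrite ltn_neqAle refines_size // andbT eq_sym.
  by apply: contra ne => /eqP e; apply/eqP; apply: refines_size_eq ba e.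
by apply: leq_trans lt _; rewrite -(refines_sumn ba) size_le_sumn.
Qed.

Lemma L_deg (a b : composition) : Lqs a (mon b) != 0 -> sumn b = sumn a.
Proof. by move=> /L_mon/refines_sumn. Qed.

Lemma psi_expansionP F : quasisymmetric F -> is_expansion psi F (coord psi F).
Proof. exact: triangular_coordP psi_inv psi_diag psi_trig psi_deg F. Qed.

Lemma psi_coordE F c : is_expansion psi F c -> coord psi F = c.
Proof. exact: triangular_coordE psi_diag psi_trig F c. Qed.

Lemma L_expansionP F : quasisymmetric F -> is_expansion Lqs F (coord Lqs F).
Proof. exact: (triangular_coordP L_inv L_diag L_trig L_deg). Qed.

Lemma L_coordE F c : is_expansion Lqs F c -> coord Lqs F = c.
Proof. exact: (triangular_coordE L_diag L_trig). Qed.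

Lemma MaxOneE F c : is_expansion Lqs F c ->
  MaxOne F = \sum_(a <- finsupp c) c a * MaxOne_hook a.
Proof. by move=> Fc; rewrite /MaxOne (L_coordE Fc). Qed.

Lemma MaxOne_L a : MaxOne (Lqs a) = MaxOne_hook a.
Proof.
pose c : coefs := [fsfun b in [fset a]%fset => 1 | 0].
have sc : finsupp c = [fset a]%fset.
  by apply/fsetP => b; rewrite mem_finsupp fsfunE !inE; case: (b == a); rewrite ?oner_eq0 ?eqxx.
have ca : c a = 1 by rewrite fsfunE inE eqxx.
rewrite (@MaxOneE _ c) /is_expansion sc big_seq_fset1 ca ?mul1r //.
by rewrite scale1r.
Qed.

Lemma MaxOne_linear x F G : quasisymmetric F -> quasisymmetric G ->
  MaxOne (x *: F + G) = x * MaxOne F + MaxOne G.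
Proof.
move=> /L_expansionP Fc /L_expansionP Gc.
set c := coord Lqs F in Fc; set e := coord Lqs G in Gc.
pose U := (finsupp c `|` finsupp e)%fset.
have wide (V : lmodType rat) (w : composition -> V) (f : coefs) :
    {subset finsupp f <= U} ->
    \sum_(a <- finsupp f) f a *: w a = \sum_(a <- U) f a *: w a.
  move=> /fsubsetP eU; apply: (big_fset_incl _ eU) => a _ ae.
  by rewrite fsfun_dflt // scale0r.
have cU : {subset finsupp c <= U} by move=> a ac; rewrite inE ac.
have eU : {subset finsupp e <= U} by move=> a ae; rewrite inE ae orbT.
pose f : coefs := [fsfun a in U => x * c a + e a | 0].
have fU : {subset finsupp f <= U}.
  by move=> a; rewrite mem_finsupp fsfunE; case: ifP; rewrite ?eqxx.
have comb (V : lmodType rat) (w : composition -> V) :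
    \sum_(a <- finsupp f) f a *: w a =
    x *: (\sum_(a <- finsupp c) c a *: w a) + \sum_(a <- finsupp e) e a *: w a.
  rewrite !wide // scaler_sumr -big_split /= big_seq [RHS]big_seq.
  by apply: eq_bigr => a aU; rewrite fsfunE aU scalerDl scalerA.
rewrite (MaxOneE Fc) (MaxOneE Gc) (@MaxOneE _ f); first exact: (comb rat^o).
by rewrite /is_expansion comb -Fc -Gc.
Qed.

Definition relabel (m m' : monom) (i : nat) : nat :=
  nth 0%N (sort leq (finsupp m')) (index i (sort leq (finsupp m))).

Section Relabel.
Variables (m m' : monom).
Hypothesis e : exponents m = exponents m'.

Let size_e : size (sort leq (finsupp m)) = size (sort leq (finsupp m')).
Proof. by rewrite -(size_map m) -[RHS](size_map m'); congr size. Qed.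

Let index_lt i : i \in finsupp m ->
  (index i (sort leq (finsupp m)) < size (sort leq (finsupp m')))%N.
Proof. by rewrite -size_e index_mem mem_sort. Qed.

Lemma relabel_mem i : i \in finsupp m -> relabel m m' i \in finsupp m'.
Proof. by move=> /index_lt h; rewrite -(mem_sort leq) mem_nth. Qed.

Lemma relabelK i : i \in finsupp m -> relabel m' m (relabel m m' i) = i.
Proof.
move=> h; rewrite /relabel index_uniq ?index_lt ?sort_uniq ?fset_uniq //.
by rewrite nth_index // mem_sort.
Qed.

Lemma relabelE i : i \in finsupp m -> m' (relabel m m' i) = m i.
Proof.
move=> h; rewrite -(nth_map _ 0%N) ?index_lt // -[map _ _]/(exponents m') -e.
by rewrite (nth_map 0%N) ?nth_index ?index_mem ?mem_sort.
Qed.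

Lemma relabel_le i j : i \in finsupp m -> j \in finsupp m -> (i <= j)%N ->
  (relabel m m' i <= relabel m m' j)%N.
Proof.
move=> hi hj ij.
have srt (k : monom) : sorted leq (sort leq (finsupp k)) := sort_sorted leq_total _.
apply: (sorted_leq_nth leq_trans leqnn) (srt m') _ _ _ _ _; rewrite ?inE ?index_lt //.
have [//|lt] := leqP (index i (sort leq (finsupp m))) (index j (sort leq (finsupp m))).
have := sorted_leq_nth leq_trans leqnn 0%N (srt m) _ _ _ _ (ltnW lt).
rewrite !inE !index_mem !mem_sort !nth_index ?mem_sort // => /(_ hj hi) ji.
have ije : i = j by apply/eqP; rewrite eqn_leq ij ji.
by rewrite ije ltnn in lt.
Qed.

End Relabel.

Section PosetLemmas.
Variables (d : Order.disp_t) (P : finPOrderType d).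

Lemma weightE (t : P -> nat) i : weight t i = #|[set x | t x == i]%SET|.
Proof.
rewrite fsfunE; case: ifP => // /negP ni; apply/esym/eqP.
rewrite cards_eq0; apply/eqP/setP => x; rewrite !inE; apply/negP => /eqP e.
by apply: ni; apply/imfsetP; exists x.
Qed.

Lemma mem_weight (t : P -> nat) x : t x \in finsupp (weight t).
Proof. by rewrite mem_finsupp weightE -lt0n card_gt0; apply/set0Pn; exists x; rewrite inE. Qed.

Lemma K_finite m :
  finite_set [set t : {ffun P -> nat} | order_preserving t /\ weight t = m].
Proof.
apply: (@sub_finite_set _ _
  ((fun u : {ffun P -> finsupp m} => [ffun x => val (u x)] : {ffun P -> nat}) @` setT)).
  move=> t [_ tm]; have tP x : t x \in finsupp m by rewrite -tm mem_weight.
  exists [ffun x => [` tP x]%fset] => //.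
  by apply/ffunP => x; rewrite !ffunE.
apply: finite_image; exact: finite_finset.
Qed.

Lemma KE m : K P m =
  \sum_(t \in [set t : {ffun P -> nat} | order_preserving t /\ weight t = m]) (1 : rat).
Proof.
rewrite /K -(fsbig_widen [set t : {ffun P -> nat} | order_preserving t /\ weight t = m]).
- by apply: eq_fsbigr => t; rewrite inE => -[_ ->]; rewrite eqxx.
- by move=> t [].
by move=> t [/= ot /not_andP[//|/eqP/negPf ->]].
Qed.

Lemma mdeg_weight (t : P -> nat) : mdeg (weight t) = #|P|.
Proof.
rewrite /mdeg /exponents sumnE big_map (perm_big (finsupp (weight t))) /=; last first.
  by rewrite perm_sort.
under eq_bigr do rewrite weightE -sum1dep_card big_mkcond /=.
rewrite exchange_big /= -sum1_card; apply: eq_bigr => x _.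
rewrite (big_fsetD1 _ (mem_weight t x)) /= eqxx.
by rewrite big1_seq ?addn0 // => i /=; rewrite !inE eq_sym => /andP[/negPf->].
Qed.

Lemma K_quasisymmetric : quasisymmetric (K P).
Proof.
split; last first.
  exists #|P| => m Km.
  have [[t [ot <-]]|no] := pselect (exists t : {ffun P -> nat}, order_preserving t /\ weight t = m).
    by rewrite mdeg_weight.
  by move: Km; rewrite KE fsbig1 ?eqxx // => t tP; case: no; exists t.
pose r (m m' : monom) (t : {ffun P -> nat}) : {ffun P -> nat} := [ffun x => relabel m m' (t x)].
pose A m := [set t : {ffun P -> nat} | order_preserving t /\ weight t = m].
have rK m m' t : exponents m = exponents m' -> A m t -> r m' m (r m m' t) = t.
  move=> e [_ tm]; apply/ffunP => x; rewrite !ffunE relabelK //.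
  by rewrite -tm mem_weight.
have rA m m' t : exponents m = exponents m' -> A m t -> A m' (r m m' t).
  move=> e [ot tm]; have tP x : t x \in finsupp m by rewrite -tm mem_weight.
  split; first by move=> x y xy; rewrite !ffunE relabel_le // ot.
  apply/fsfunP => i; rewrite weightE; have [im'|im'] := boolP (i \in finsupp m').
    rewrite -(relabelE (esym e) im').
    have := weightE t (relabel m' m i); rewrite tm => ->.
    apply: eq_card => x; rewrite !inE !ffunE; apply/eqP/eqP => [<-|->].
      by rewrite relabelK.
    by rewrite relabelK.
  rewrite fsfun_dflt //; apply/eqP; rewrite cards_eq0; apply/eqP/setP => x.
  rewrite !inE !ffunE; apply: contraNF im' => /eqP <-; exact: relabel_mem.
move=> m m' e; rewrite !KE -/(A m) -/(A m').
rewrite (@reindex_fsbig _ _ _ _ _ (r m m') (A m) (A m')) //; split.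
- by move=> t; apply: rA.
- move=> t u; rewrite !inE => tA uA /(congr1 (r m' m)); by rewrite !rK.
by move=> t tA; exists (r m' m t); [apply: rA | apply: rK].
Qed.
End PosetLemmas.

(* Main.v *)
Require Import Defs.
From mathcomp Require Import boolp classical_sets fsbigop.
From mathcomp Require Import all_boot all_order all_algebra finmap zify ring.

(** Peeling off principal filters from the top of [P] shows that [K P] is the sum
    of [psi] over the order-preserving surjections whose fibers all have a least
    element, each indexed by its fiber sizes. Such a surjection has at least as
    many fibers as [P] has minimal elements; when there are equally many, it is
    determined by the order it induces on the minimal elements, and every order
    occurs. So [Ktilde P] is a sum over the orderings of the minimal elements.

    [MaxOne] sends the monomial function of [(b_1, ..., b_l)] to [(-1)^(l-1) b_1],
    and hence [psi a] to the alternating sum over [j] of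
    [1 / (pi (a_1, ..., a_(j-1)) * pi (a_l, ..., a_(j+1)))]. Times [(n-1)!], each
    term is, by the hook length formula, the number of linear extensions of a
    forest: of the labelings in which the least label of each block is at its
    minimal element and the labels of the minimal elements first decrease and then
    increase along the ordering, with label 1 at position [j]. For a fixed labeling
    satisfying the second zigzag condition, the compatible pairs (ordering, [j])
    correspond to the sets of minimal elements violating the first condition, and
    the signed count vanishes unless there is no violation. *)

Set Implicit Arguments.
Unset Strict Implicit.
Unset Printing Implicit Defensive.

Import Order.TTheory GRing.Theory Num.Theory.
Local Open Scope ring_scope.

(** * Orderings of finite sets and alternating sums over subsets *)

Section Orderings.
Variable T : finType.

Definition orderings (A : {set T}) : seq (seq T) := permutations (enum A).

Lemma orderings_uniq (A : {set T}) : uniq (orderings A).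
Proof. exact: permutations_uniq. Qed.

Lemma mem_orderings (A : {set T}) s :
  (s \in orderings A) = uniq s && [forall x, (x \in s) == (x \in A)].
Proof.
rewrite mem_permutations; apply/idP/andP => [sA|[us /forallP sA]].
  split; first by rewrite (perm_uniq sA) enum_uniq.
  by apply/forallP => x; rewrite (perm_mem sA) mem_enum.
by apply: uniq_perm => // [|x]; rewrite ?enum_uniq // mem_enum (eqP (sA x)).
Qed.

Lemma orderingsP (A : {set T}) s :
  reflect [/\ uniq s, s =i A & size s = #|A|] (s \in orderings A).
Proof.
apply: (iffP idP) => [|[us sA _]].
  rewrite mem_orderings => /andP[us /forallP sA].
  have sA' : s =i A by move=> x; rewrite (eqP (sA x)).
  by split=> //; rewrite -(card_uniqP us) (eq_card sA').
by rewrite mem_orderings us; apply/forallP => x; rewrite sA.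
Qed.

Lemma orderings0 : orderings set0 = [:: [::]].
Proof. by rewrite /orderings enum_set0. Qed.

Lemma big_orderings (R : Type) (idx : R) (op : Monoid.com_law idx)
    (A : {set T}) (F : seq T -> R) : A != set0 ->
  \big[op/idx]_(s <- orderings A) F s =
  \big[op/idx]_(x in A) \big[op/idx]_(s <- orderings (A :\ x)) F (x :: s).
Proof.
move=> A0; rewrite (perm_big _ (permutationsE _)) /=; last by rewrite -cardE card_gt0.
rewrite big_allpairs_dep /= undup_id ?enum_uniq // big_enum /=.
apply: eq_bigr => x xA; apply: perm_big; apply: perm_permutations.
apply: uniq_perm; rewrite ?rem_uniq ?enum_uniq // => y.
by rewrite mem_rem_uniq ?enum_uniq // !inE !mem_enum !inE.
Qed.

(** Inserting or removing [v] is an involution on the subsets of [D] that reverses the sign of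
    [F]. *)
Lemma sum_toggle (R : zmodType) (D : {set T}) (F : {set T} -> R) (v : T) :
  v \in D -> (forall A : {set T}, v \notin A -> F (v |: A) = - F A) ->
  \sum_(A : {set T} | A \subset D) F A = 0.
Proof.
move=> vD FN; rewrite (bigID (fun A : {set T} => v \in A)) /=.
rewrite (reindex_onto (fun A => v |: A) (fun A => A :\ v)) /=; last first.
  by move=> A /andP[_ vA]; rewrite setD1K.
rewrite (eq_bigl (fun A : {set T} => (A \subset D) && (v \notin A))); last first.
  move=> A; rewrite subUset sub1set vD /= setU11 andbT; congr andb.
  apply/eqP/idP => [<-|vA]; first by rewrite setD11.
  by rewrite setU1K.
rewrite -big_split big1 //= => A /andP[_ vA]; by rewrite FN // addNr.
Qed.

Lemma sum_sign_subset (D : {set T}) :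
  \sum_(A : {set T} | A \subset D) (-1) ^+ #|A| = (D == set0)%:R :> rat.
Proof.
have [->|/set0Pn[v vD]] := eqVneq D set0.
  rewrite (eq_bigl (pred1 set0)) ?big_pred1_eq ?cards0 // => A.
  by rewrite subset0.
by rewrite (sum_toggle vD) // => A vA; rewrite cardsU1 vA add1n exprS mulN1r.
Qed.

End Orderings.

(* A copy of [index] on finite types, immune to the several inference paths to
   the [eqType] of a finite poset. *)
Definition pos (T : finType) (s : seq T) (x : T) : nat := index x s.

Lemma pos_inj (T : finType) (s : seq T) x y :
  x \in s -> y \in s -> pos s x = pos s y -> x = y.
Proof. by move=> xs ys e; rewrite -[LHS](nth_index x xs) -/(pos s x) e nth_index. Qed.

Lemma in_take_pos (T : finType) (s : seq T) j x :
  x \in s -> (x \in take j s) = (pos s x < j)%N.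
Proof. exact: in_take. Qed.

Lemma pos_nth (T : finType) (s : seq T) x0 i :
  uniq s -> (i < size s)%N -> pos s (nth x0 s i) = i.
Proof. by move=> us si; rewrite /pos index_uniq. Qed.

(** * Hook length formula for forests *)

Section Hook.
Variables (T : finType) (H : T -> {set T}).
Hypothesis H_refl : forall w, w \in H w.
Hypothesis H_trans : forall w z, z \in H w -> H z \subset H w.
Hypothesis H_anti : forall w z, z \in H w -> w \in H z -> w = z.
Hypothesis H_forest :
  forall x w z, x \in H w -> x \in H z -> (w \in H z) || (z \in H w).

Definition respects (phi : T -> nat) : bool :=
  [forall w, forall z in H w, (phi w <= phi z)%N].

Let respects_on (A : {set T}) (r : seq T) : bool :=
  [forall w in A, forall z in H w, (pos r w <= pos r z)%N].

Let root (A : {set T}) (w : T) : bool := [forall (z | (z \in A) && (w \in H z)), w == z].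

(** Each element of [A] is counted exactly once: among the members of [A] that have it as a
    descendant, one with the largest hook is a root, and [H_forest] excludes a second root. *)
Let sum_root (A : {set T}) : (forall w, w \in A -> H w \subset A) ->
  (\sum_(w in A | root A w) #|H w| = #|A|)%N.
Proof.
move=> clA; under eq_bigr do rewrite -sum1_card big_mkcond /=.
rewrite exchange_big /= -sum1_card [RHS]big_mkcond /=; apply: eq_bigr => x _.
case: ifP => xA; last first.
  rewrite big1 // => w /andP[wA _]; case: ifP => // xw.
  by rewrite (subsetP (clA w wA)) in xA.
pose D w := (w \in A) && (x \in H w).
have Dx : D x by rewrite /D xA H_refl.
case: (arg_maxnP (fun w => #|H w|) Dx) => w /andP[wA xw] wmax.
have wroot : root A w.
  apply/forallP => z; apply/implyP => /andP[zA wz].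
  have HH := H_trans wz.
  have /wmax le : D z by rewrite /D zA (subsetP HH).
  apply/eqP/(H_anti _ wz).
  have/eqP -> : H w == H z by rewrite eqEcard HH.
  exact: H_refl.
rewrite (bigD1 w) ?wA ?wroot //= xw big1 ?addn0 // => z /andP[/andP[zA zr] zw].
case: ifP => // xz; case/negP: zw; have /orP[zw|wz] := H_forest xz xw.
  by have /forallP/(_ w) := zr; rewrite wA zw.
by have /forallP/(_ z) := wroot; rewrite zA wz eq_sym.
Qed.

(** Induction on [A]: an ordering that respects the forest starts at a root [x], its tail respects
    the forest on [A :\ x], and the factors [#|H x|] contributed by the roots add up to [#|A|]. *)
Let hook_formula_on (A : {set T}) : (forall w, w \in A -> H w \subset A) ->
  ((\sum_(r <- orderings A) respects_on A r) * \prod_(w in A) #|H w| = (#|A|)`!)%N.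
Proof.
have [n] := ubnP #|A|; elim: n A => // n IH A; rewrite ltnS => An clA.
have [->|A0] := eqVneq A set0.
  rewrite cards0 big_set0 muln1 orderings0 big_seq1 /respects_on.
  by apply/eqP; rewrite eqb1; apply/forallP => w; rewrite inE.
rewrite big_orderings // big_distrl /=.
have -> : ((#|A|)`! = #|A| * (#|A|.-1)`!)%N.
  by move: A0; rewrite -card_gt0; case: #|A|.
rewrite -{1}(sum_root clA) big_distrl /= [LHS](bigID (root A)) /=.
rewrite [X in (_ + X)%N]big1 ?addn0 => [|x /andP[xA xr]].
  apply: eq_bigr => x /andP[xA xr]; have cAx : #|A :\ x| = #|A|.-1.
    by rewrite [#|A|](cardsD1 x) xA.
  rewrite (bigD1 x) //= mulnCA; congr muln.
  have xH z : z \in A -> x \in H z -> z = x.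
    by move=> zA xz; have /forallP/(_ z) := xr; rewrite zA xz /= => /eqP.
  rewrite -cAx -(IH (A :\ x)); last first.
  - move=> w; rewrite !inE => /andP[wx wA]; apply/subsetP => z zw.
    rewrite !inE (subsetP (clA w wA)) // andbT; apply: contra wx => /eqP zx.
    by rewrite (xH w) // -zx.
  - rewrite cAx; move: A0 An; rewrite -card_gt0; lia.
  congr muln; last by apply: eq_bigl => w; rewrite !inE andbC.
  rewrite big_seq [RHS]big_seq; apply: eq_bigr => r _; congr nat_of_bool.
  apply/forallP/forallP => h w; apply/implyP.
    rewrite !inE => /andP[wx wA]; apply/forallP => z; apply/implyP => zw.
    have := h w; rewrite wA => /forallP/(_ z); rewrite zw /pos /=.
    by rewrite eq_sym (negPf wx); case: eqP.
  move=> wA; apply/forallP => z; apply/implyP => zw; rewrite /pos /=.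
  case: eqP => // /eqP; rewrite eq_sym => wx; case: eqP => [xz|_].
    by case/eqP: wx; apply: xH; rewrite // xz.
  by have := h w; rewrite !inE wx wA => /forallP/(_ z); rewrite zw.
rewrite big1 ?mul0n // => r _; apply/eqP; rewrite eqb0; apply: contra xr.
move=> /forallP h; apply/forallP => z; apply/implyP => /andP[zA xz].
have := h z; rewrite zA => /forallP/(_ x); rewrite xz /pos /= eqxx eq_sym.
by case: eqP => //= ->.
Qed.

(* The hook length formula for forests: [H w] is the set of descendants of [w]. *)
Lemma hook_formula :
  ((\sum_(r <- orderings [set: T]) respects (pos r)) * \prod_w #|H w| = (#|T|)`!)%N.
Proof.
rewrite -cardsT -hook_formula_on => [|w _]; last exact: finset.subsetT.
congr muln; last by apply: eq_bigl => w; rewrite inE.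
apply: eq_bigr => r _; congr nat_of_bool.
by apply: eq_forallb => w; rewrite inE.
Qed.

End Hook.

(** * Minimal elements, and labelings as orderings *)

Section MinimalElements.
Variables (d : Order.disp_t) (P : finPOrderType d).

Definition minimals (A : {set P}) : {set P} :=
  [set x in A | [forall y in A, ~~ (y < x)%O]].

Lemma minimalsT x : reflect (minimal x) (x \in minimals [set: P]).
Proof.
rewrite inE in_setT /=; apply: (iffP forallP) => [h y|h y].
  by apply/negP; have := h y; rewrite in_setT.
by apply/implyP => _; apply/negP/h.
Qed.

Lemma minimals_eq (A : {set P}) x y :
  x \in minimals A -> y \in A -> (y <= x)%O -> y = x.
Proof.
rewrite inE => /andP[_ /forallP/(_ y)] + yA; rewrite yA le_eqVlt /=.
by move=> /negPf->; rewrite orbF => /eqP.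
Qed.

Lemma minimals_sub (A : {set P}) : minimals A \subset A.
Proof. by apply/subsetP => x; rewrite inE => /andP[]. Qed.

(** Among the elements of [A] below [x], one with the fewest elements of [A] below it is minimal. *)
Lemma minimals_below (A : {set P}) x : x \in A ->
  exists2 y, y \in minimals A & (y <= x)%O.
Proof.
move=> xA; have Dx : (x \in A) && (x <= x)%O by rewrite xA lexx.
case: (@arg_minnP _ x (fun y => (y \in A) && (y <= x)%O)
  (fun y => #|[set z in A | (z <= y)%O]|) Dx) => y /andP[yA yx] ymin.
exists y => //; rewrite inE yA; apply/forallP => z; apply/implyP => zA.
apply/negP => zy; have := ymin z; rewrite zA (le_trans (ltW zy) yx) => /(_ isT).
apply/negP; rewrite -ltnNge; apply: proper_card; apply/properP; split.
  apply/subsetP => t; rewrite !inE => /andP[-> /= tz]; exact: le_trans tz (ltW zy).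
by exists y; rewrite !inE yA ?lexx //= lt_geF.
Qed.

(** The zigzag conditions without bijectivity, so that they apply to [pos r]; the label 1 is
    represented by 0. *)
Definition zigzag_condition (phi : P -> nat) : Prop :=
  (forall x, minimal x -> phi x <> 0%N ->
     exists y, (x < y)%O /\ (phi y < phi x)%N) /\
  (forall x, ~ minimal x ->
     exists y, [/\ minimal y, (y < x)%O & (phi y < phi x)%N]).

(** Listing [P] by increasing label turns a bijective labeling into an ordering [r], and [pos r]
    recovers the labels. *)
Lemma card_zigzag_labelings : #|zigzag_labelings P| =
  (\sum_(r <- orderings [set: P]) `[< zigzag_condition (pos r) >])%N.
Proof.
(* [enum_rank x] is only a default for [insubd]; it is never reached when [r] is an ordering of
   [P]. *)
pose lab (r : seq P) : {ffun P -> 'I_#|P|} :=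
  [ffun x => insubd (enum_rank x) (pos r x)].
have labE r x : r \in orderings [set: P] -> lab r x = pos r x :> nat.
  case/orderingsP=> _ rT sr; rewrite ffunE insubdK //= unfold_in.
  by rewrite /pos -cardsT -sr index_mem rT inE.
pose S := [seq r <- orderings [set: P] | `[< zigzag_condition (pos r) >]].
rewrite -big_mkcond sum1_count -size_filter -/S -(size_map lab) cardE.
apply: perm_size; apply: uniq_perm; first exact: enum_uniq.
  rewrite map_inj_in_uniq ?filter_uniq ?orderings_uniq // => r r'.
  rewrite !mem_filter => /andP[_ rT] /andP[_ r'T] e.
  have ei x : pos r x = pos r' x by rewrite -!labE // e.
  case/orderingsP: rT => ur rm sr; case/orderingsP: r'T => ur' rm' sr'.
  have [r0|[x0 _]] : r = [::] \/ exists x0 : P, true.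
    by case: (r) => [|x ?]; [left|right; exists x].
    by rewrite r0; apply/esym/size0nil; rewrite sr' -sr r0.
  apply: (@eq_from_nth _ x0); first by rewrite sr.
  move=> i ir; rewrite -[in RHS](pos_nth x0 ur ir) ei nth_index //.
  by rewrite rm' inE.
move=> f; rewrite mem_enum inE; apply/asboolP/mapP => [[[g fK gK] f1 f2]|[r + ->]].
  pose r := [seq g i | i <- enum 'I_#|P|].
  have ur : uniq r by rewrite map_inj_uniq ?enum_uniq //; apply: can_inj gK.
  have rT : r \in orderings [set: P].
    apply/orderingsP; split => [//|x|]; last by rewrite size_map -cardE card_ord cardsT.
    by rewrite inE; apply/mapP; exists (f x); rewrite ?mem_enum.
  have ir x : pos r x = f x.
    by rewrite -{1}[x]fK /pos index_map ?index_enum_ord //; apply: can_inj gK.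
  exists r; last by apply/ffunP => x; apply: val_inj; rewrite /= labE ?ir.
  rewrite mem_filter rT andbT; apply/asboolP; split=> x.
    move=> /f1 h; rewrite ir => /h[y [xy ?]]; exists y; by rewrite !ir.
  by move=> /f2[y []]; exists y; rewrite !ir.
rewrite mem_filter => /andP[/asboolP[z1 z2] rT].
have linj : injective (lab r).
  move=> x y /(congr1 val) /=; rewrite !labE // => e.
  case/orderingsP: rT => ur rm sr.
  by apply: (@pos_inj _ r); rewrite ?rm ?inE.
split; first by apply: inj_card_bij; rewrite // card_ord.
  by move=> x /z1 h; rewrite /= labE // => /h[y []]; exists y; rewrite !labE.
by move=> x /z2[y []]; exists y; rewrite !labE.
Qed.

End MinimalElements.

(** * The forest attached to an ordering of the minimal elements and a center *)

Section Caterpillar.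
Variables (d : Order.disp_t) (P : finPOrderType d).
Let M := minimals [set: P].

(* The linear extensions of the forest with these sets of descendants are the
   labelings that decrease along [s] up to position [j], increase afterwards, and
   have the least label of each block at its minimal element; the block of the
   entry [w] of [s] consists of the elements for which [w] is the first entry of
   [s] below them. *)
Definition hook (s : seq P) (j : nat) (w : P) : {set P} :=
  if w \in M then
    if (pos s w < j)%N then
      [set x | [exists y in M, (y <= x)%O && (pos s y <= pos s w)%N]]
    else if pos s w == j then [set: P]
    else [set x | [forall y in M, (y <= x)%O ==> (pos s w <= pos s y)%N]]
  else [set w].

Section HookLemmas.
Variables (s : seq P) (j : nat).
Hypothesis sM : s \in orderings M.

Let hpos_inj : {in M &, injective (pos s)}.
Proof.
by case/orderingsP: sM => _ sm _ x y xM yM; apply: pos_inj; rewrite sm.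
Qed.

Variant hook_spec (w : P) : {set P} -> Prop :=
| HookBefore of w \in M & (pos s w < j)%N : hook_spec w
    [set x | [exists y in M, (y <= x)%O && (pos s y <= pos s w)%N]]
| HookCenter of w \in M & pos s w = j : hook_spec w [set: P]
| HookAfter of w \in M & (j < pos s w)%N : hook_spec w
    [set x | [forall y in M, (y <= x)%O ==> (pos s w <= pos s y)%N]]
| HookLeaf of w \notin M : hook_spec w [set w].

Lemma hookP w : hook_spec w (hook s j w).
Proof.
rewrite /hook; case: ifPn => [wM|wM]; last exact: HookLeaf.
by case: ltngtP => h; [exact: HookBefore|exact: HookAfter|exact: HookCenter].
Qed.

Let memM_le x y : y \in M -> x \in M -> (y <= x)%O -> y = x.
Proof. by move=> yM xM; apply: (minimals_eq xM); rewrite in_setT. Qed.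

Lemma hook_refl w : w \in hook s j w.
Proof.
case: hookP => [wM lt|_ _|wM gt|_]; rewrite ?inE //.
  by apply/existsP; exists w; rewrite wM lexx leqnn.
by apply/forallP => y; apply/implyP => yM; apply/implyP => /(memM_le yM wM) ->.
Qed.

Let hook_before w x : w \in M -> (pos s w < j)%N ->
  reflect (exists y, [/\ y \in M, (y <= x)%O & (pos s y <= pos s w)%N])
          (x \in hook s j w).
Proof.
move=> wM lt; rewrite /hook wM lt inE; apply: (iffP existsP).
  by move=> [y /and3P[? ? ?]]; exists y.
by move=> [y [? ? ?]]; exists y; apply/and3P.
Qed.

Let hook_center w x : w \in M -> pos s w = j -> x \in hook s j w.
Proof. by move=> wM e; rewrite /hook wM e ltnn eqxx inE. Qed.

Let hook_after w x : w \in M -> (j < pos s w)%N ->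
  reflect (forall y, y \in M -> (y <= x)%O -> (pos s w <= pos s y)%N)
          (x \in hook s j w).
Proof.
move=> wM gt; rewrite /hook wM ltnNge (ltnW gt) gtn_eqF // inE.
apply: (iffP forallP) => h y; first by move=> yM yx; have := h y; rewrite yM yx.
by apply/implyP => yM; apply/implyP; apply: h.
Qed.

Let hook_leaf w x : w \notin M -> (x \in hook s j w) = (x == w).
Proof. by move=> wM; rewrite /hook (negPf wM) inE. Qed.

(** A minimal element has no other minimal element below it, so on [M] descent depends on positions
    only: two arms leave the center, which sits at position [j]. *)
Let hookM w z : w \in M -> z \in M -> (z \in hook s j w) =
  if (pos s w < j)%N then (pos s z <= pos s w)%N
  else if pos s w == j then true else (pos s w <= pos s z)%N.
Proof.
move=> wM zM; case: ltngtP => h; last exact: hook_center.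
  apply/(hook_before _ wM h)/idP => [[y [yM yz le]]|le].
    by rewrite -(memM_le yM zM yz).
  by exists z.
apply/(hook_after _ wM h)/idP => [|le y yM yz]; first by apply.
by rewrite (memM_le yM zM yz).
Qed.

Let below x : exists2 y, y \in M & (y <= x)%O.
Proof. by apply: minimals_below; rewrite inE. Qed.

Lemma hook_trans w z : z \in hook s j w -> hook s j z \subset hook s j w.
Proof.
have [zM|zM] := boolP (z \in M); last first.
  by move=> zw; apply/subsetP => x; rewrite hook_leaf // => /eqP ->.
have [wM|wM] := boolP (w \in M); last first.
  by rewrite hook_leaf // => /eqP zw; rewrite -zw zM in wM.
rewrite hookM //; case: ltngtP => wj h; apply/subsetP => x.
- have zj : (pos s z < j)%N by apply: leq_ltn_trans h wj.
  move=> /(hook_before _ zM zj)[y [yM yx le]].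
  by apply/(hook_before _ wM wj); exists y; split=> //; apply: leq_trans le h.
- have zj : (j < pos s z)%N by apply: leq_trans wj h.
  move=> /(hook_after _ zM zj) hx; apply/(hook_after _ wM wj) => y yM yx.
  exact: leq_trans h (hx y yM yx).
by move=> _; apply: hook_center.
Qed.

Lemma hook_anti w z : z \in hook s j w -> w \in hook s j z -> w = z.
Proof.
have [zM|zM] := boolP (z \in M); last first.
  by move=> _; rewrite hook_leaf // => /eqP.
have [wM|wM] := boolP (w \in M); last first.
  by rewrite hook_leaf // => /eqP.
rewrite !hookM // => h1 h2; apply: hpos_inj => //; move: h1 h2.
by case: (ltngtP (pos s w) j) => ?; case: (ltngtP (pos s z) j) => ?; lia.
Qed.

(** Two entries on the same arm are comparable. Entries on different arms share no descendant: one
    requires a minimal element below [x] at a position before [j], the other forbids it. *)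
Lemma hook_forest x w z : x \in hook s j w -> x \in hook s j z ->
  (w \in hook s j z) || (z \in hook s j w).
Proof.
have [zM|zM] := boolP (z \in M); last first.
  by move=> h; rewrite hook_leaf // => /eqP <-; rewrite h orbT.
have [wM|wM] := boolP (w \in M); last first.
  by rewrite hook_leaf // => /eqP <- ->.
move=> xw xz; rewrite !hookM //.
case: (ltngtP (pos s w) j) xw =>
  [wj /(hook_before _ wM wj)[y [yM yx le]]|wj /(hook_after _ wM wj) hw|];
  last by rewrite orbT.
  case: (ltngtP (pos s z) j) xz => // zj; first by rewrite leq_total.
  by move=> /(hook_after _ zM zj)/(_ y yM yx); lia.
case: (ltngtP (pos s z) j) xz => // zj; last by rewrite leq_total.
by move=> /(hook_before _ zM zj)[y [yM yx le]]; have := hw y yM yx; lia.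
Qed.

Section Labeling.
Variable phi : P -> nat.
Hypothesis phi_inj : injective phi.
Hypothesis phi_resp : respects (hook s j) phi.

Let respP w z : z \in hook s j w -> (phi w <= phi z)%N.
Proof. by move=> zw; have /forallP/(_ w)/forallP/(_ z) := phi_resp; rewrite zw. Qed.

(** The witness is the first entry of [s] below [x]: then [x] lies in its block, hence among its
    descendants. *)
Lemma respects_nonminimal x : x \notin M ->
  exists y, [/\ y \in M, (y < x)%O & (phi y < phi x)%N].
Proof.
move=> xM; pose D y := (y \in M) && (y <= x)%O.
have [y0 y0M y0x] := below x; have Dy0 : D y0 by rewrite /D y0M.
case: (arg_minnP (pos s) Dy0) => y /andP[yM yx] ymin.
have yltx : (y < x)%O.
  by rewrite lt_neqAle yx andbT; apply: contraNneq xM => <-.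
exists y; split=> //; rewrite ltn_neqAle; apply/andP; split.
  by apply: contraTneq yltx => /phi_inj ->; rewrite ltxx.
apply: respP; case: (ltngtP (pos s y) j) => yj; last exact: hook_center.
  by apply/(hook_before _ yM yj); exists y.
by apply/(hook_after _ yM yj) => z zM zx; apply: ymin; rewrite /D zM.
Qed.

Lemma respects_before w x : w \in M -> (pos s w < j)%N -> (w < x)%O ->
  (phi w < phi x)%N.
Proof.
move=> wM wj wx; rewrite ltn_neqAle; apply/andP; split.
  by apply: contraTneq wx => /phi_inj ->; rewrite ltxx.
by apply: respP; apply/(hook_before _ wM wj); exists w; rewrite leqnn ltW.
Qed.

Lemma respects_center w x : w \in M -> pos s w = j -> (phi w <= phi x)%N.
Proof. by move=> wM wj; apply: respP; apply: hook_center. Qed.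

Lemma respects_minimals w z : w \in M -> z \in M ->
  (if (pos s w < j)%N then (pos s z <= pos s w)%N
   else (pos s w <= pos s z)%N) -> (phi w <= phi z)%N.
Proof.
move=> wM zM h; apply: respP; rewrite hookM //; move: h.
by case: ltngtP.
Qed.
End Labeling.

(** A descendant of an entry [w] on an arm is minimal itself or lies above a minimal descendant of
    [w] with no larger label. Hence comparisons among minimal elements and along the order
    suffice. *)
Lemma respects_intro (phi : P -> nat) :
  (forall w, w \in M -> pos s w = j -> phi w = 0%N) ->
  {in M &, forall w z, (if (pos s w < j)%N then (pos s z <= pos s w)%N
     else (pos s w <= pos s z)%N) -> (phi w <= phi z)%N} ->
  (forall w x, w \in M -> (pos s w < j)%N -> (w < x)%O -> (phi w <= phi x)%N) ->
  (forall x, x \notin M ->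
     exists y, [/\ y \in M, (y < x)%O & (phi y < phi x)%N]) ->
  respects (hook s j) phi.
Proof.
move=> h0 hM hb hn; apply/forallP => w; apply/forallP => z; apply/implyP.
have [wM|wM] := boolP (w \in M); last by rewrite hook_leaf // => /eqP ->.
case: (ltngtP (pos s w) j) => wj; last by rewrite h0.
  move=> /(hook_before _ wM wj)[y [yM yz le]].
  have yj := leq_ltn_trans le wj; apply: (@leq_trans (phi y)).
    by apply: hM; rewrite // wj.
  by move: yz; rewrite le_eqVlt => /predU1P[->//|]; apply: hb.
move=> /(hook_after _ wM wj) h.
have wj' : (pos s w < j)%N = false by lia.
have [zM|zM] := boolP (z \in M).
  by apply: hM => //; rewrite wj'; apply: h.
have [y [yM yz lt]] := hn z zM; apply: leq_trans (ltnW lt).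
by apply: hM => //; rewrite wj'; apply/h/ltW.
Qed.

End HookLemmas.

(** * Compatible pairs of a fixed labeling, counted with sign *)

Section Signs.
Variable phi : P -> nat.
Hypothesis phi_inj : injective phi.
Variable N : nat.
Hypothesis phi_lt : forall x, (phi x < N)%N.
Hypothesis phi0 : exists x, phi x = 0%N.

Let cond2 := forall x, x \notin M ->
  exists y, [/\ y \in M, (y < x)%O & (phi y < phi x)%N].

(* The minimal elements at which the first zigzag condition fails. *)
Let V : {set P} :=
  [set w in M | (phi w != 0%N) && [forall x, (w < x)%O ==> (phi w < phi x)%N]].

(* Sorting by [key A] puts the elements of [A] first, by decreasing label, and
   then the others, by increasing label. *)
Let key (A : {set P}) (x : P) : nat := if x \in A then (N - phi x)%N else (N + phi x)%N.
Let ley A : rel P := fun x y => (key A x <= key A y)%N.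
Let vsort (A : {set P}) : seq P := sort (ley A) (enum M).

Let key_inj A : injective (key A).
Proof.
move=> x y; rewrite /key => e; apply: phi_inj.
by move: e (phi_lt x) (phi_lt y); do 2!case: ifP => _; lia.
Qed.

Let vsort_mem A : vsort A \in orderings M.
Proof.
apply/orderingsP; split; first by rewrite sort_uniq enum_uniq.
  by move=> x; rewrite mem_sort mem_enum.
by rewrite size_sort -cardE.
Qed.

Let ley_trans A : transitive (ley A).
Proof. by move=> y x z; apply: leq_trans. Qed.

Let ley_total A : total (ley A).
Proof. by move=> x y; apply: leq_total. Qed.

Let vsort_uniq A s : s \in orderings M -> sorted (ley A) s -> s = vsort A.
Proof.
move=> sM ss; apply: (sorted_eq (@ley_trans A)) => //.
- by move=> x y; rewrite /ley -eqn_leq => /eqP/key_inj.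
- exact: sort_sorted (@ley_total A) _.
by move: sM; rewrite mem_permutations => sp; rewrite perm_sym perm_sort perm_sym.
Qed.

(** The set [A] of entries before the center determines the pair: labels decrease on [A] and
    increase afterwards, which is sortedness for [key A]. Entries of [A] lie in [V] because the
    center has the least label and an early entry has a smaller label than everything above it. *)
Let compat_imp s j A : s \in orderings M -> (j < #|M|)%N ->
  A = [set x in take j s] -> respects (hook s j) phi ->
  [/\ s = vsort A, j = #|A| & A \subset V].
Proof.
move=> sM jM As resp; case/orderingsP: (sM) => us sm ss.
have inA x : x \in M -> (x \in A) = (pos s x < j)%N.
  by move=> xM; rewrite As inE in_take_pos // sm.
have [x0 _] := phi0.
have nthM i : (i < #|M|)%N -> nth x0 s i \in M by rewrite -ss -sm; apply: mem_nth.
have idx i : (i < #|M|)%N -> pos s (nth x0 s i) = i.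
  by rewrite -ss => ?; rewrite pos_nth.
split.
- apply: vsort_uniq => //; apply/(sortedP x0) => i; rewrite ss => iM.
  have iM' := ltnW iM; rewrite /ley /key !inA ?nthM // !idx //.
  have := respects_minimals resp (nthM _ iM) (nthM _ iM').
  have := respects_minimals resp (nthM _ iM') (nthM _ iM).
  rewrite !idx //; do 2!case: ifP; lia.
- rewrite As cardsE (card_uniqP _) ?take_uniq // size_takel // ss; exact: ltnW.
apply/subsetP => w wA; have wM : w \in M.
  by move: wA; rewrite As inE => /mem_take; rewrite sm.
have wj : (pos s w < j)%N by rewrite -inA.
rewrite inE wM /=; apply/andP; split.
  apply/negP => /eqP w0.
  have := respects_center resp w (nthM _ jM) (idx _ jM).
  rewrite w0 leqn0 -w0 => /eqP/phi_inj e.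
  by move: wj; rewrite -e idx // ltnn.
by apply/forallP => x; apply/implyP; apply: (respects_before phi_inj resp).
Qed.

(** The element [y0] with label 0 is minimal by [cond2] and lies outside [V]. Its key is [N], so in
    [vsort A] it comes directly after [A] and serves as the center. *)
Let compat_conv (A : {set P}) : cond2 -> A \subset V ->
  [/\ (#|A| < #|M|)%N, A = [set x in take #|A| (vsort A)]
    & respects (hook (vsort A) #|A|) phi].
Proof.
move=> c2 AV; have [y0 y00] := phi0.
have y0M : y0 \in M.
  by apply/negPn/negP => /c2[y [_ _]]; rewrite y00.
have AM : A \subset M.
  by apply: fintype.subset_trans AV _; apply/subsetP => x; rewrite inE => /andP[].
have y0A : y0 \notin A.
  by apply/negP => /(subsetP AV); rewrite inE y00 eqxx andbF.
have AltM : (#|A| < #|M|)%N.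
  by apply: proper_card; apply/properP; split=> //; exists y0.
have sM := vsort_mem A; case/orderingsP: (sM) => us sm ss.
have srt : sorted (ley A) (vsort A) by apply: sort_sorted (@ley_total A) _.
have keyle x y : x \in M -> y \in M ->
    (pos (vsort A) x <= pos (vsort A) y)%N -> (key A x <= key A y)%N.
  move=> xM yM; apply: (sorted_leq_index (@ley_trans A) _ srt); rewrite ?sm //.
  by move=> z; rewrite /ley.
have Apos w : w \in A -> (0 < phi w)%N.
  by move=> /(subsetP AV); rewrite inE lt0n => /and3P[].
have eA : A = [set x in take #|A| (vsort A)].
  apply/eqP; rewrite eqEcard; apply/andP; split; last first.
    by rewrite cardsE (card_uniqP _) ?take_uniq // size_takel // ss ltnW.
  apply/subsetP => w wA; have wM := subsetP AM w wA.
  rewrite inE in_take_pos ?sm //.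
  (* All entries up to [w] have keys below [N] and so belong to [A]; counting them bounds the
     position of [w]. *)
  have -> : (pos (vsort A) w).+1 = #|[set x in take (pos (vsort A) w).+1 (vsort A)]|.
    rewrite cardsE (card_uniqP _) ?take_uniq // size_takel //.
    by rewrite /pos index_mem sm.
  apply: subset_leq_card; apply/subsetP => x; rewrite inE => xt.
  have xM : x \in M by rewrite -sm; apply: mem_take xt.
  move: xt; rewrite in_take_pos ?sm // ltnS => /(keyle x w xM wM).
  rewrite /key wA; case: ifP => // _; move: (Apos w wA) (phi_lt w); clear; lia.
have inA x : x \in M -> (x \in A) = (pos (vsort A) x < #|A|)%N.
  by move=> xM; rewrite {1}eA inE in_take_pos // sm.
split=> //; apply: respects_intro => //.
- move=> w wM wj; have wA : w \notin A by rewrite inA // wj ltnn.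
  have := keyle w y0 wM y0M; rewrite wj leqNgt -inA // y0A => /(_ isT).
  rewrite /key (negPf wA) (negPf y0A) y00; clear; lia.
- move=> w z wM zM; rewrite -inA //; case: ifP => wA h.
    have := keyle z w zM wM h; rewrite /key wA.
    by case: ifP => _; move: (phi_lt z) (phi_lt w) (Apos w wA); clear; lia.
  have := keyle w z wM zM h; rewrite /key wA.
  case: ifP => zA; last by clear; lia.
  by move: (Apos z zA) (phi_lt z); clear; lia.
move=> w x wM; rewrite -inA // => /(subsetP AV); rewrite inE => /and3P[_ _].
by move=> /forallP/(_ x)/implyP h /h/ltnW.
Qed.

Lemma sum_sign_compatible :
  \sum_(s <- orderings M) \sum_(j < #|M|) (-1) ^+ j *+ respects (hook s j) phi
  = (`[< zigzag_condition phi >])%:R :> rat.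
Proof.
have VP : V == set0 <->
    (forall x, minimal x -> phi x <> 0%N ->
       exists y, (x < y)%O /\ (phi y < phi x)%N).
  split=> [/eqP V0 x /minimalsT xM x0|h].
    have : x \notin V by rewrite V0 inE.
    rewrite inE -/M xM /= negb_and negbK => /orP[/eqP //|].
    rewrite negb_forall => /existsP[y]; rewrite negb_imply -leqNgt => /andP[xy le].
    exists y; split=> //; rewrite ltn_neqAle le andbT.
    by apply: contraTneq xy => /phi_inj ->; rewrite ltxx.
  apply/eqP/setP => x; rewrite [in RHS]inE; apply/negP.
  rewrite inE => /and3P[/minimalsT xM /eqP x0].
  move=> /forallP hx; have [y [xy lt]] := h x xM x0.
  by have := hx y; rewrite xy /= ltnNge ltnW.
have c2P : cond2 <-> (forall x, ~ minimal x ->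
     exists y, [/\ minimal y, (y < x)%O & (phi y < phi x)%N]).
  split=> h x.
    by move=> /minimalsT/h[y [/minimalsT ? ? ?]]; exists y.
  move=> xM; have [|y [/minimalsT ? ? ?]] := h x; last by exists y.
  by apply/minimalsT.
(* If the second condition fails, [respects_nonminimal] rules out every compatible pair. *)
have [c2|nc2] := pselect cond2; last first.
  rewrite big_seq big1 ?asboolF //; first by move=> [_ /c2P].
  move=> s sM; rewrite big1 // => j _; case: (boolP (respects _ _)) => // resp.
  by case: nc2; apply: (respects_nonminimal phi_inj resp).
transitivity (\sum_(A : {set P} | A \subset V) (-1) ^+ #|A| : rat); last first.
  rewrite sum_sign_subset; congr (nat_of_bool _)%:R; apply/idP/asboolP.
    by move=> /VP ?; split=> //; apply/c2P.
  by move=> [/VP].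
(* Expand compatibility over [A]: only the set of the first [j] entries of [s] can contribute, and
   it does exactly when the pair is compatible. *)
transitivity (\sum_(s <- orderings M) \sum_(j < #|M|) \sum_(A : {set P})
   ((s == vsort A) && (j == #|A| :> nat) && (A \subset V))%:R * (-1) ^+ #|A| : rat).
  rewrite big_seq [RHS]big_seq; apply: eq_bigr => s sM; apply: eq_bigr => j _.
  rewrite (bigD1 [set x in take j s]) //= big1 ?addr0 => [|A nA].
    set A := [set x in take j s].
    case: (boolP (respects _ _)) => [resp|nresp].
      have [e1 e2 e3] := compat_imp sM (ltn_ord j) (erefl A) resp.
      by rewrite -e1 -e2 !eqxx e3 mul1r.
    rewrite mulr0n; case: (boolP (_ && _)) => [|_]; last by rewrite mul0r.
    move=> /andP[/andP[/eqP e1 /eqP e2] e3].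
    have [_ _] := compat_conv c2 e3.
    by rewrite -e1 -e2 (negPf nresp).
  case: (boolP (_ && _)) => [/andP[/andP[/eqP e1 /eqP e2] e3]|_]; last by rewrite mul0r.
  have [_ eA _] := compat_conv c2 e3.
  by case/eqP: nA; rewrite {1}eA -e1 -e2.
under eq_bigr do rewrite exchange_big /=.
rewrite exchange_big /= [RHS]big_mkcond /=; apply: eq_bigr => A _.
case: ifP => AV; last by rewrite big1 // => s _; rewrite big1 // => j _; rewrite andbF mul0r.
have [lt _ _] := compat_conv c2 AV.
rewrite (bigD1_seq (vsort A)) ?orderings_uniq ?vsort_mem //= [X in _ + X]big1 ?addr0.
  rewrite (bigD1 (Ordinal lt)) //= !eqxx mul1r big1 ?addr0 // => j nj.
  rewrite (_ : (j == #|A| :> nat) = false) ?mul0r //.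
  by apply: contraNF nj => /eqP e; apply/eqP/val_inj.
by move=> s ns; rewrite big1 // => j _; rewrite (negPf ns) mul0r.
Qed.

End Signs.
End Caterpillar.

(** * Hook products in terms of block sizes, and the zigzag count *)

Definition power_sum_hook (g : seq nat) (j i : nat) : nat :=
  if (i < j)%N then sumn (take i.+1 g) else sumn (drop i g).

(* The value of [MaxOne] on the power sum indexed by the reversal of [g]. *)
Definition MaxOne_rev_psi (g : seq nat) : rat :=
  \sum_(j < size g) (-1) ^+ j /
    (\prod_(i < size g | i != j) power_sum_hook g j i)%:R.

Section Blocks.
Variables (d : Order.disp_t) (P : finPOrderType d).

Definition upper (x : P) : {set P} := [set y | (x <= y)%O].

(** The fiber sizes encoded by [s]: an element of [A] is counted at the first entry of [s] below
    it. *)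
Fixpoint block_sizes (A : {set P}) (s : seq P) : seq nat :=
  if s is x :: s' then #|A :&: upper x| :: block_sizes (A :\: upper x) s' else [::].

Lemma size_block_sizes A s : size (block_sizes A s) = size s.
Proof. by elim: s A => //= x s IH A; rewrite IH. Qed.

Definition above (s : seq P) (x : P) : bool := has (fun y => (y <= x)%O) s.

Lemma sumn_take_block_sizes A s i :
  sumn (take i (block_sizes A s)) = #|[set x in A | above (take i s) x]|.
Proof.
elim: s A i => [|x s IH] A [|i] /=.
- by apply/esym/eqP; rewrite cards_eq0; apply/eqP/setP => y; rewrite !inE andbF.
- by apply/esym/eqP; rewrite cards_eq0; apply/eqP/setP => y; rewrite !inE andbF.
- by apply/esym/eqP; rewrite cards_eq0; apply/eqP/setP => y; rewrite !inE andbF.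
rewrite IH -[RHS](cardsID (upper x)); congr addn; apply: eq_card => y.
  by rewrite !inE; case: (x <= y)%O; rewrite ?andbT ?andbF ?andTb //=.
by rewrite !inE; case: (x <= y)%O; rewrite ?andbT ?andbF ?andTb //=.
Qed.

Lemma sumn_drop_block_sizes (A : {set P}) s i : (forall x, x \in A -> above s x) ->
  sumn (drop i (block_sizes A s)) = #|[set x in A | ~~ above (take i s) x]|.
Proof.
move=> As; have := sumn_take_block_sizes A s (size s).
rewrite take_oversize ?size_block_sizes // -{1}(cat_take_drop i (block_sizes A s)).
rewrite sumn_cat sumn_take_block_sizes take_size.
rewrite (_ : [set x in A | above s x] = A); last first.
  by apply/setP => x; rewrite inE; case: (boolP (x \in A)) => // /As.
rewrite -[in RHS](cardsID [set x | above (take i s) x] A) => e.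
have e1 : #|A :&: [set x | above (take i s) x]| = #|[set x in A | above (take i s) x]|.
  by apply: eq_card => x; rewrite !inE.
move: e; rewrite e1 => /addnI ->; apply: eq_card => x; by rewrite !inE andbC.
Qed.

Let M := minimals [set: P].

Lemma above_minimals s x : s \in orderings M -> above s x.
Proof.
case/orderingsP=> _ sm _.
have [|y yM yx] := @minimals_below _ P [set: P] x; first by rewrite inE.
by apply/hasP; exists y; rewrite ?sm.
Qed.

(** Before the center the hook is the union of the blocks up to [i]; after it, the hook is the
    complement of the blocks preceding [i]. *)
Lemma card_hook s j x0 i : s \in orderings M -> (i < #|M|)%N -> i != j ->
  #|hook s j (nth x0 s i)| = power_sum_hook (block_sizes [set: P] s) j i.
Proof.
move=> sM iM ij; case/orderingsP: (sM) => us sm ss.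
have nM : nth x0 s i \in M by rewrite -sm mem_nth // ss.
have pn : pos s (nth x0 s i) = i by rewrite pos_nth // ss.
rewrite /hook nM pn /power_sum_hook; case: ltnP => [lt|ge].
  rewrite sumn_take_block_sizes; apply: eq_card => x; rewrite !inE.
  apply/existsP/hasP => [[y /and3P[yM yx le]]|[y yt yx]].
    by exists y => //; rewrite in_take_pos ?sm // ltnS.
  exists y; have ys := mem_take yt; rewrite -sm ys yx /=.
  by rewrite -ltnS -in_take_pos.
rewrite (negPf ij) sumn_drop_block_sizes; last by move=> x _; apply: above_minimals.
apply: eq_card => x; rewrite !inE; apply/forallP/hasPn => h y.
  move=> yt; have ys := mem_take yt; apply/negP => yx.
  have := h y; rewrite -sm ys yx /= leqNgt -in_take_pos //.
  by rewrite yt.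
apply/implyP => yM; apply/implyP => yx; rewrite leqNgt -in_take_pos ?sm //.
by apply/negP => /h; rewrite yx.
Qed.

(** In the hook length formula the nonminimal elements contribute 1, and the hook of the center is
    all of [P]; cancelling it turns [#|P|] factorial into the stated one. *)
Lemma count_respects s (j : 'I_#|M|) : (0 < #|P|)%N -> s \in orderings M ->
  ((\sum_(r <- orderings [set: P]) respects (hook s j) (pos r)) *
   \prod_(i < #|M| | i != j) power_sum_hook (block_sizes [set: P] s) j i
   = (#|P| - 1)`!)%N.
Proof.
move=> n0 sM; case/orderingsP: (sM) => us sm ss.
have := hook_formula (@hook_refl _ _ s j) (@hook_trans _ _ s j)
  (@hook_anti _ _ s j sM) (@hook_forest _ _ s j sM).
rewrite (bigID (fun w => w \in M)) /= [X in (_ * (_ * X))%N]big1 ?muln1; last first.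
  by move=> w wM; rewrite /hook (negPf wM) cards1.
have [x0 _] : exists x0 : P, true by move/card_gt0P: n0 => [x _]; exists x.
have -> : (\prod_(w in M) #|hook s j w| = \prod_(i < #|M|) #|hook s j (nth x0 s i)|)%N.
  rewrite -(eq_bigl _ _ sm) -big_uniq //= (big_nth x0) ss big_mkord //.
have nM : nth x0 s j \in M by rewrite -sm mem_nth // ss.
have hookT : #|hook s j (nth x0 s j)| = #|P|.
  by rewrite /hook nM pos_nth ?ss // ltnn eqxx cardsT.
rewrite (bigD1 j) //= hookT.
rewrite (eq_bigr (fun i : 'I_#|M| => power_sum_hook (block_sizes [set: P] s) j i)); last first.
  by move=> i ij; rewrite card_hook //.
rewrite mulnCA; case: #|P| n0 => // n _; rewrite factS subn1 /= => /eqP.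
by rewrite eqn_pmul2l // => /eqP.
Qed.

(** Double counting of labelings [r] against pairs [(s, j)]: for fixed [r] the signs add up to the
    zigzag indicator, for a fixed pair the hook length formula counts the labelings. *)
Lemma card_zigzag_MaxOne : (0 < #|P|)%N -> #|zigzag_labelings P|%:R =
  (#|P| - 1)`!%:R * \sum_(s <- orderings M) MaxOne_rev_psi (block_sizes [set: P] s).
Proof.
move=> n0; rewrite card_zigzag_labelings natr_sum mulr_sumr.
transitivity (\sum_(r <- orderings [set: P]) \sum_(s <- orderings M)
    \sum_(j < #|M|) (-1) ^+ j *+ respects (hook s j) (pos r) : rat).
  rewrite big_seq [RHS]big_seq; apply: eq_bigr => r rT.
  case/orderingsP: rT => ur rm sr.
  apply/esym/(@sum_sign_compatible _ _ _ _ #|P|).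
  - by move=> x y; apply: pos_inj; rewrite rm inE.
  - by move=> x; rewrite /pos -cardsT -sr index_mem rm inE.
  have [x0 _] : exists x0 : P, true by move/card_gt0P: n0 => [x _]; exists x.
  by exists (nth x0 r 0); rewrite pos_nth // sr cardsT.
rewrite exchange_big /= big_seq [RHS]big_seq; apply: eq_bigr => s sM.
case/orderingsP: (sM) => us sm ss.
rewrite exchange_big /= /MaxOne_rev_psi size_block_sizes ss mulr_sumr.
apply: eq_bigr => j _; rewrite -(count_respects j n0 sM).
rewrite natrM natr_sum mulrCA mulfK.
  by rewrite mulr_sumr; apply: eq_bigr => r _; rewrite mulr_natr.
rewrite pnatr_eq0; apply/eqP => e; have := count_respects j n0 sM.
by rewrite e muln0 => /esym/eqP; rewrite -leqn0 leqNgt fact_gt0.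
Qed.

End Blocks.

(** * Compositions of an integer, and [MaxOne] on monomial functions *)

Definition compo (s : seq nat) : composition :=
  insubd (Composition (isT : all (leq 1) [::])) s.

Lemma compoK s : all (leq 1) s -> compo s = s :> seq nat.
Proof. by move=> sP; rewrite /compo insubdK. Qed.

Lemma compo_parts (a : composition) : compo a = a.
Proof. by apply: val_inj; rewrite /= compoK // partsP. Qed.

(** [k] is fuel bounding the number of parts; any [k] with [n <= k] yields all compositions of
    [n]. *)
Fixpoint comps_rec (k n : nat) : seq (seq nat) :=
  if n == 0%N then [:: [::]] else
  if k is k'.+1 then [seq i :: c | i <- iota 1 n, c <- comps_rec k' (n - i)]
  else [::].

Lemma comps_recS k n : comps_rec k.+1 n.+1 =
  [seq i :: c | i <- iota 1 n.+1, c <- comps_rec k (n.+1 - i)].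
Proof. by []. Qed.

Definition comps (n : nat) : seq (seq nat) := comps_rec n n.

Lemma comps_recE k n : (n <= k)%N -> comps_rec k n = comps n.
Proof.
suff H m : forall k k' n, (n <= m)%N -> (n <= k)%N -> (n <= k')%N ->
    comps_rec k n = comps_rec k' n by move=> nk; apply: (H n).
elim: m => [|m IH] {}k k' {}n; first by rewrite leqn0 => /eqP->; case: k; case: k'.
case: n => [|n]; first by case: k; case: k'.
case: k k' => [//|k] [//|k'] nm nk nk'; rewrite !comps_recS; congr (flatten _).
apply/eq_in_map => i; rewrite mem_iota => /andP[i1 _].
by rewrite (IH k k') //; lia.
Qed.

Lemma big_comps (G : seq nat -> rat) n :
  \sum_(b <- comps n.+1) G b =
  \sum_(1 <= i < n.+2) \sum_(b <- comps (n.+1 - i)) G (i :: b).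
Proof.
rewrite /comps comps_recS big_allpairs_dep /index_iota subn1.
rewrite big_seq [RHS]big_seq.
apply: eq_bigr => i; rewrite mem_iota => /andP[i1 _].
by rewrite comps_recE //; lia.
Qed.

Lemma mem_comps n b : (b \in comps n) = all (leq 1) b && (sumn b == n).
Proof.
have [m] := ubnP n; elim: m n b => // m IH [|n] b nm.
  by rewrite inE; case: b => [|[|x] b] //=; rewrite andbF.
rewrite /comps comps_recS; apply/allpairsPdep/andP => [[i [c [+ + ->]]]|[]].
  rewrite mem_iota => /andP[i1 ilt].
  rewrite comps_recE; last by lia.
  rewrite IH; last by lia.
  by move=> /andP[cP /eqP cn] /=; split; [apply/andP|rewrite cn; lia].
case: b => [//|i c] /= /andP[i1 cP] /eqP e; exists i, c; split=> //.
  by change (i \in iota 1 n.+1); rewrite mem_iota; lia.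
rewrite comps_recE; last by lia.
by rewrite IH ?cP /=; lia.
Qed.

(** Puts back what remains of a partly consumed part, if anything does. *)
Definition cons_pos (x : nat) (a : seq nat) : seq nat :=
  if x == 0%N then a else x :: a.

Fixpoint refinesb (b a : seq nat) : bool :=
  match b, a with
  | [::], [::] => true
  | k :: b', x :: a' => (k <= x)%N && refinesb b' (cons_pos (x - k) a')
  | _, _ => false
  end.

Lemma refinesbP b a : all (leq 1) b -> all (leq 1) a ->
  reflect (exists g, is_blocks b a g) (refinesb b a).
Proof.
move=> bP aP; apply: (iffP idP).
  elim: b a bP aP => [|k b IH] [|x a] //= => [_ _ _|]; first by exists [::].
  move=> /andP[k1 bP] /andP[x1 aP] /andP[kx]; rewrite /cons_pos subn_eq0.
  case: ltnP => [ltkx|xk].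
    move=> /IH[//|/=|[|h g] [//= e1 [e2 e3]]].
      by rewrite subn_gt0 ltkx.
    exists ((k :: h) :: g); split=> /=; first by rewrite e1.
    by rewrite e2 subnKC // e3.
  move=> /IH[//|//|g [e1 e2]]; exists ([:: k] :: g); split=> /=; first by rewrite e1.
  by rewrite addn0 e2; congr cons; apply/eqP; rewrite eqn_leq kx xk.
elim: b a bP aP => [|k b IH] a bP aP [g [gb ga]].
  move: aP; rewrite -ga; case: g gb {ga} => // h g /=.
  by case: h => //= h0; rewrite /= -?h0.
case: g gb ga => [//|h g] /= gb ga; move: aP; rewrite -ga /= => /andP[h0 aP].
case: h gb ga h0 => [//|y h] /= [ek gb] ga _; subst y.
have bP' : all (leq 1) b by case/andP: bP.
rewrite leq_addr /= addKn; apply: IH => //.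
  rewrite /cons_pos; case: eqP => //= /eqP; rewrite -lt0n => h0.
  by rewrite h0 aP.
rewrite /cons_pos; case: eqP => [h0|_]; last by exists (h :: g); split.
have hnil : h = [::].
  apply: sumn_pos_eq0 h0; move: bP'; rewrite -gb all_cat => /andP[] //.
by exists g; split=> //; rewrite -gb hnil.
Qed.

Lemma Lqs_compo (a b : seq nat) : all (leq 1) a -> all (leq 1) b ->
  Lqs (compo a) (mon (compo b)) = (refinesb b a)%:R.
Proof.
move=> aP bP; rewrite LqsE mcomp_mon; congr (nat_of_bool _)%:R.
by apply/asboolP/refinesbP => //; rewrite /refines !compoK.
Qed.

Section HookValue.

Let Z (a : seq nat) : rat := \sum_(b <- comps (sumn a)) (-1) ^+ size b *+ refinesb b a.

Let sumn_cons_pos x a : sumn (cons_pos x a) = (x + sumn a)%N.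
Proof. by rewrite /cons_pos; case: eqP => [->|]. Qed.

(** A refinement starts with a part [x.+1 - y], where [y] is what it leaves of the first part; the
    remaining parts refine [cons_pos y a]. *)
Let first_part (W : nat -> rat) x a :
  \sum_(b <- comps (x.+1 + sumn a))
    W (head 0%N b) * (-1) ^+ (size b).-1 *+ refinesb b (x.+1 :: a)
  = \sum_(y < x.+1) W (x.+1 - y)%N * Z (cons_pos y a).
Proof.
rewrite addSn big_comps (big_cat_nat _ (n := x.+2)) //=; last by lia.
rewrite [X in _ + X]big1_seq ?addr0; last first.
  move=> i /andP[_]; rewrite mem_index_iota => /andP[i1 _]; rewrite big1 // => b _.
  by rewrite /= leqNgt i1.
rewrite big_nat_rev big_add1 /= big_mkord; apply: eq_bigr => y _.
have -> : (1 + x.+2 - y.+2 = x.+1 - y)%N by lia.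
have ylt := ltn_ord y.
rewrite /Z sumn_cons_pos (_ : (x + sumn a).+1 - (x.+1 - y) = y + sumn a)%N; last by lia.
rewrite mulr_sumr; apply: eq_bigr => b _.
rewrite leq_subr subKn 1?ltnW //= mulrnAr //.
Qed.

Let ZE x a : Z (x.+1 :: a) = - \sum_(y < x.+1) Z (cons_pos y a).
Proof.
rewrite -mulN1r mulr_sumr -(first_part (fun=> -1)) /Z /=.
rewrite !addSn !big_comps; apply: eq_bigr => i _; apply: eq_bigr => b _ /=.
by rewrite exprS.
Qed.

(** The last summand of the recurrence [ZE] is [Z (x.+1 :: a)], which by [ZE] again is minus the sum
    of the others. *)
Let Z_ge2 x a : Z (x.+2 :: a) = 0.
Proof.
by rewrite ZE big_ord_recr /= {1}/cons_pos /= ZE subrr oppr0.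
Qed.

Let Z_val a : all (leq 1) a -> Z a = (-1) ^+ size a *+ (a == nseq (size a) 1%N).
Proof.
elim: a => [_|[|[|x]] a IH aP] //=; first by rewrite /Z /= big_seq1.
by rewrite ZE big_ord1 /cons_pos /= IH // exprS mulN1r mulNrn eqseq_cons eqxx.
Qed.

(** The functional with value [(-1)^(l-1) b_1] on the monomial function of [b], cut down to degree
    [n.+1], takes the values prescribed for [MaxOne] on the [Lqs]. *)
Lemma sum_comps_Lqs n (a : composition) :
  \sum_(b <- comps n.+1) (head 0%N b)%:R * (-1) ^+ (size b).-1 *
     Lqs a (mon (compo b)) = MaxOne_hook a *+ (sumn a == n.+1).
Proof.
transitivity (\sum_(b <- comps n.+1) (head 0%N b)%:R * (-1) ^+ (size b).-1
   *+ refinesb b a : rat).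
  rewrite big_seq [RHS]big_seq; apply: eq_bigr => b; rewrite mem_comps => /andP[bP _].
  by rewrite -{1}[a]compo_parts Lqs_compo ?partsP // mulr_natr.
case: eqP => [an|an]; last first.
  rewrite big_seq big1 // => b; rewrite mem_comps => /andP[bP /eqP bn].
  case: refinesbP => //; first exact: partsP.
  by move=> [g /is_blocks_sumn]; rewrite bn => /esym.
rewrite -an /MaxOne_hook; move: an (partsP a); case: (parts a) => [//|[//|x] a'] /= an a'P.
rewrite (first_part (fun k => k%:R)).
(* By [Z_ge2] only the remainders 0 and 1 survive; their weights [x.+1] and [x] meet opposite values
   of [Z]. *)
have -> : \sum_(y < x.+1) (x.+1 - y)%:R * Z (cons_pos y a') = Z a'.
  rewrite big_ord_recl subn0 /cons_pos /=; case: x an => [|x] an.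
    by rewrite big_ord0 addr0 mul1r.
  rewrite big_ord_recl big1 ?addr0 => [|i _]; last by rewrite Z_ge2 mulr0.
  rewrite /bump /= subn1 /= ZE big_ord1 /cons_pos /= mulrN -mulrBl -natrB //.
  by rewrite subSnn mul1r.
rewrite Z_val //; case: pickP => [k /eqP[e1 e2]|nok].
  have -> : size a' = k by have := congr1 size e2; rewrite size_nseq.
  by rewrite -e2 eqxx.
case: eqP => // ea.
have ks : (size a' < x.+1 + sumn a')%N.
  by rewrite addSn ltnS ea sumn_nseq mul1n size_nseq leq_addl.
have := nok (Ordinal ks); rewrite /= -ea.
by rewrite {2}ea sumn_nseq mul1n addnK !eqxx.
Qed.

End HookValue.

(* [MaxOne] takes the value [(-1)^(l-1) b_1] on the monomial function of
   [b = (b_1, ..., b_l)]. *)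
Lemma MaxOne_comps F N : quasisymmetric F ->
  (forall m, F m != 0 -> mdeg m = N.+1) ->
  MaxOne F = \sum_(b <- comps N.+1) (head 0%N b)%:R * (-1) ^+ (size b).-1 * F (mon (compo b)).
Proof.
move=> /L_expansionP Fc FN; rewrite /MaxOne; set c := Defs.coord Lqs F in Fc *.
pose Phi n (G : power_series) := \sum_(b <- comps n.+1)
  (head 0%N b)%:R * (-1) ^+ (size b).-1 * G (mon (compo b)).
have PhiF n : Phi n F = \sum_(a <- finsupp c) c a * (MaxOne_hook a *+ (sumn a == n.+1)).
  rewrite /Phi {1}Fc; under eq_bigr do rewrite ps_sumE mulr_sumr.
  rewrite exchange_big /=; apply: eq_bigr => a _.
  rewrite -sum_comps_Lqs mulr_sumr; apply: eq_bigr => b _.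
  by rewrite ps_scaleE mulrCA.
(* Summing over all degrees up to [K] avoids showing that the expansion of [F] is homogeneous; the
   degrees other than that of [F] contribute 0 by [PhiZ]. *)
pose K := (\max_(a <- finsupp c) sumn a + N.+1)%N.
have KP (a : composition) : a \in finsupp c -> (sumn a <= K)%N.
  move=> ac; apply: leq_trans (leq_addr _ _).
  by rewrite (big_rem a) //= leq_maxl.
have PhiZ n : n != N -> Phi n F = 0.
  move=> nN; rewrite /Phi big_seq big1 // => b; rewrite mem_comps => /andP[bP /eqP bn].
  apply/eqP; rewrite mulf_eq0; apply/orP; right; apply/negPn/negP => /FN.
  rewrite /mdeg exponents_mon compoK // bn => -[e].
  by rewrite e eqxx in nN.
rewrite -/(Phi N F); transitivity (\sum_(n < K) Phi n F); last first.
  have NK : (N < K)%N by rewrite /K; lia.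
  rewrite (bigD1 (Ordinal NK)) //= big1 ?addr0 // => i iN.
  by apply: PhiZ; apply: contra iN => /eqP e; apply/eqP/val_inj.
under [RHS]eq_bigr do rewrite PhiF.
rewrite exchange_big /= big_seq [RHS]big_seq; apply: eq_bigr => a ac.
have := KP a ac; case e : (sumn a) => [|n] an.
  rewrite big1 ?mulr0 // => [|i _]; last by rewrite mulr0.
  rewrite /MaxOne_hook; case: pickP => [k|]; last by rewrite mulr0.
  by case: k => k /=; rewrite e.
rewrite (bigD1 (Ordinal an)) //= eqxx big1 ?addr0 // => i ni.
rewrite (_ : (n.+1 == i.+1) = false) ?mulr0 //.
by apply: contraNF ni => /eqP[e']; apply/eqP/val_inj.
Qed.

(** * Coefficients of the power sums and their [MaxOne] *)

Lemma psi_compo (a b : seq nat) g : all (leq 1) a -> all (leq 1) b ->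
  is_blocks a b g ->
  psi (compo a) (mon (compo b)) = (\prod_(h <- g) (pi_comp h)%:R^-1).
Proof.
move=> aP bP gP; have gP' : is_blocks (compo a) (compo b) g by rewrite !compoK.
rewrite psiE mcomp_mon asboolT; last by exists g.
by rewrite /pi_ref (blocks_eq gP') natr_prod prodfV.
Qed.

Lemma psi_compo0 (a b : seq nat) : all (leq 1) a -> all (leq 1) b ->
  (forall g, ~ is_blocks a b g) -> psi (compo a) (mon (compo b)) = 0.
Proof.
move=> aP bP h; rewrite psiE mcomp_mon asboolF //= => -[g].
by rewrite !compoK // => /h.
Qed.

(* A second computation of the coefficients of [psi a], splitting off the first
   block of [a]. *)
Fixpoint psi_coef (a b : seq nat) : rat :=
  if b is k :: b' then
    \sum_(j < size a) (sumn (take j.+1 a) == k)%:R / (pi_comp (take j.+1 a))%:R *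
      psi_coef (drop j.+1 a) b'
  else (a == [::])%:R.

Lemma sumn_take_inj a i j : all (leq 1) a -> (i <= size a)%N -> (j <= size a)%N ->
  sumn (take i a) = sumn (take j a) -> i = j.
Proof.
elim: a i j => [|x a IH] [|i] [|j] //= /andP[x1 aP]; try lia.
by rewrite !ltnS => ia ja /addnI /IH ->.
Qed.

Lemma sumn_take_gt0 a j : all (leq 1) a -> (j < size a)%N ->
  (0 < sumn (take j.+1 a))%N.
Proof. by case: a => [|x a] //= /andP[x1 _] _; rewrite addn_gt0 x1. Qed.

Lemma psi_coef_blocks a b g : all (leq 1) a -> all (leq 1) b -> is_blocks a b g ->
  psi_coef a b = \prod_(h <- g) (pi_comp h)%:R^-1.
Proof.
elim: g a b => [|h g IH] a b aP bP [ga gb].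
  by rewrite -gb -ga /= big_nil.
move: bP; rewrite -gb big_cons /= => /andP[h0 bP].
have sh : (0 < size h)%N by case: (h) h0.
have ha : (size h <= size a)%N by rewrite -ga /= size_cat leq_addr.
have jlt : ((size h).-1 < size a)%N by rewrite prednK.
have th : take (size h) a = h by rewrite -ga /= take_size_cat.
(* Partial sums of [a] are injective, so only the cut just after [h] hits the first part of [b]. *)
rewrite (bigD1 (Ordinal jlt)) //= prednK // th eqxx mul1r.
rewrite big1 ?addr0.
  congr *%R; apply: IH => //; last by rewrite -ga /= drop_size_cat.
  by move: aP; rewrite -{1}(cat_take_drop (size h) a) all_cat => /andP[].
move=> j nj; case: eqP => [e|]; last by rewrite mul0r mul0r.
case/negP: nj; apply/eqP/val_inj => /=.
have := @sumn_take_inj a j.+1 (size h) aP (ltn_ord j) ha.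
by rewrite e th => /(_ erefl) <-.
Qed.

Lemma psi_coef_neq0 a b : psi_coef a b != 0 -> exists g, is_blocks a b g.
Proof.
elim: b a => [|k b IH] a /=.
  by have [->|_] := eqVneq a [::]; [exists [::]|rewrite eqxx].
have [j|h] := pickP (fun j : 'I_(size a) =>
  (sumn (take j.+1 a) == k) && (psi_coef (drop j.+1 a) b != 0)).
  move=> /andP[/eqP jk /IH[g [g1 g2]]] _; exists (take j.+1 a :: g).
  by split; rewrite /= ?g1 ?g2 ?jk ?cat_take_drop.
rewrite big1 ?eqxx // => j _; have /negbT := h j; rewrite negb_and negbK.
by case: (_ == k) => /= [/eqP->|_]; rewrite ?mulr0 ?mul0r.
Qed.

Lemma psi_compoE a b : all (leq 1) a -> all (leq 1) b ->
  psi (compo a) (mon (compo b)) = psi_coef a b.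
Proof.
move=> aP bP; have [[g gP]|no] := pselect (exists g, is_blocks a b g).
  by rewrite (psi_compo aP bP gP) (psi_coef_blocks aP bP gP).
rewrite psi_compo0 // => [|g gP]; last by case: no; exists g.
by apply/esym/eqP/negPn/negP => /psi_coef_neq0.
Qed.

(** The first block of [a] fixes the first part of [b], so a weight that factors through head and
    tail splits along the cut. *)
Lemma sum_psi_coef (W : nat -> rat) (V : seq nat -> rat) a n :
  all (leq 1) a -> sumn a = n.+1 ->
  \sum_(b <- comps n.+1) W (head 0%N b) * V (behead b) * psi_coef a b =
  \sum_(j < size a) W (sumn (take j.+1 a)) / (pi_comp (take j.+1 a))%:R *
    \sum_(b <- comps (sumn (drop j.+1 a))) V b * psi_coef (drop j.+1 a) b.
Proof.
move=> aP an; rewrite big_comps /=.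
under eq_bigr => i _ do (under eq_bigr do rewrite mulr_sumr; rewrite exchange_big /=).
rewrite exchange_big /=; apply: eq_bigr => j _.
have sj : (sumn (take j.+1 a) + sumn (drop j.+1 a) = n.+1)%N.
  by rewrite -sumn_cat cat_take_drop.
have s0 := sumn_take_gt0 aP (ltn_ord j).
have sin : sumn (take j.+1 a) \in index_iota 1 n.+2 by rewrite mem_index_iota; lia.
rewrite (bigD1_seq _ sin (iota_uniq _ _)) /= [X in _ + X]big1 ?addr0.
  rewrite eqxx (_ : n.+1 - _ = sumn (drop j.+1 a))%N; last by lia.
  by rewrite mulr_sumr; apply: eq_bigr => b _; rewrite mul1r; ring.
by move=> i ni; rewrite big1 // => b _; rewrite eq_sym (negPf ni) !mul0r mulr0.
Qed.

Lemma pi_comp_rcons s x : pi_comp (rcons s x) = (pi_comp s * sumn (rcons s x))%N.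
Proof.
rewrite /pi_comp size_rcons big_ord_recr /=; congr muln.
  by apply: eq_bigr => i _; rewrite -cats1 takel_cat //= ltn_ord.
by rewrite take_oversize // size_rcons.
Qed.

Lemma pi_comp_takeS j a : (j < size a)%N ->
  pi_comp (take j.+1 a) = (pi_comp (take j a) * sumn (take j.+1 a))%N.
Proof. by move=> ja; rewrite (take_nth 0%N) // pi_comp_rcons. Qed.

Lemma pi_comp_rev_dropS j a : (j < size a)%N ->
  pi_comp (rev (drop j a)) = (pi_comp (rev (drop j.+1 a)) * sumn (drop j a))%N.
Proof.
move=> ja; rewrite (drop_nth 0%N) // rev_cons pi_comp_rcons.
by rewrite -rev_cons sumn_rev.
Qed.

Section Alternating.
Variable a : seq nat.
Hypothesis aP : all (leq 1) a.

Let take_pos j : all (leq 1) (take j a).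
Proof. by move: aP; rewrite -{1}(cat_take_drop j a) all_cat => /andP[]. Qed.

Let drop_pos j : all (leq 1) (drop j a).
Proof. by move: aP; rewrite -{1}(cat_take_drop j a) all_cat => /andP[]. Qed.

Let pt j : ((pi_comp (take j a))%:R : rat) != 0.
Proof. by rewrite pnatr_eq0 -lt0n pi_comp_gt0. Qed.

Let pd j : ((pi_comp (rev (drop j a)))%:R : rat) != 0.
Proof. by rewrite pnatr_eq0 -lt0n pi_comp_gt0 // all_rev. Qed.

(** Multiplying by [sumn a = sumn (take j a) + sumn (drop j a)] gives two sums. In each the new
    factor cancels the last factor of one [pi_comp], and after a shift of [j] they are negatives of
    each other. *)
Lemma pi_comp_alternating : a != [::] ->
  \sum_(j < (size a).+1) (-1) ^+ j /
    ((pi_comp (take j a))%:R * (pi_comp (rev (drop j a)))%:R) = 0 :> rat.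
Proof.
move=> a0; set l := size a.
have n0 : ((sumn a)%:R : rat) != 0.
  by rewrite pnatr_eq0; apply: contra a0 => /eqP/sumn_pos_eq0 ->.
apply: (mulfI n0); rewrite mulr0 mulr_sumr.
pose U j : rat := (-1) ^+ j /
  ((pi_comp (take j a))%:R * (pi_comp (rev (drop j.+1 a)))%:R).
pose A j : rat := (sumn (take j a))%:R * ((-1) ^+ j /
    ((pi_comp (take j a))%:R * (pi_comp (rev (drop j a)))%:R)).
pose B j : rat := (sumn (drop j a))%:R * ((-1) ^+ j /
    ((pi_comp (take j a))%:R * (pi_comp (rev (drop j a)))%:R)).
have sd j : (j < l)%N -> ((sumn (drop j a))%:R : rat) != 0.
  move=> jl; rewrite pnatr_eq0; apply/eqP => /(sumn_pos_eq0 (drop_pos j)).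
  by move=> /(congr1 size) /=; rewrite size_drop => /eqP; rewrite subn_eq0 leqNgt jl.
have st j : (j < l)%N -> ((sumn (take j.+1 a))%:R : rat) != 0.
  by move=> jl; rewrite pnatr_eq0 -lt0n sumn_take_gt0.
transitivity (\sum_(j < l.+1) (A j + B j)).
  apply: eq_bigr => j _; rewrite -mulrDl -natrD -sumn_cat.
  by rewrite cat_take_drop.
rewrite big_split /= big_ord_recl [X in _ + X]big_ord_recr /=.
rewrite {1}/A take0 mul0r add0r {2}/B drop_size mul0r addr0 -big_split big1 //= => j _.
have -> : bump 0 j = j.+1 by [].
rewrite /A /B [pi_comp (rev (drop j a))]pi_comp_rev_dropS // pi_comp_takeS // exprS !natrM.
have := sd j (ltn_ord j); have := st j (ltn_ord j).
have := pt j; have := pd j.+1.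
move: (_ ^+ _) => e p1 p2 s1 s2; field.
by rewrite ?p1 ?p2 ?s1 ?s2.
Qed.

End Alternating.

(** Splitting off the first block yields, by induction and up to a common sign, all terms of
    [pi_comp_alternating] except the one at 0, which is the claimed value. *)
Lemma sum_sign_psi_coef a : all (leq 1) a ->
  \sum_(b <- comps (sumn a)) (-1) ^+ size b * psi_coef a b =
  (-1) ^+ size a / (pi_comp (rev a))%:R.
Proof.
have [m] := ubnP (size a); elim: m a => // m IH a am aP.
have [->|a0] := eqVneq a [::].
  by rewrite /comps /= big_seq1 /= /pi_comp big_ord0 divr1.
have [n an] : exists n, sumn a = n.+1.
  case: (a) a0 aP => // -[//|x] a' _ _; by exists (x + sumn a')%N.
rewrite an; transitivity (\sum_(b <- comps n.+1) (fun=> -1) (head 0%N b) *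
   (-1) ^+ (size (behead b)) * psi_coef a b).
  rewrite !big_comps; apply: eq_bigr => i _; apply: eq_bigr => b _ /=.
  by rewrite exprS.
rewrite (sum_psi_coef (fun=> -1) (fun b => (-1) ^+ size b) aP an).
have := pi_comp_alternating aP a0; rewrite big_ord_recl drop0 take0 /=.
rewrite /pi_comp big_ord0 -/(pi_comp (rev a)) mul1r => e.
have {e} e : (pi_comp (rev a))%:R^-1 = \sum_(j < size a) - ((-1) ^+ j.+1 /
    ((pi_comp (take j.+1 a))%:R * (pi_comp (rev (drop j.+1 a)))%:R)) :> rat.
  by rewrite sumrN; apply/eqP; rewrite -addr_eq0 -[X in _ == X]e mul1r.
rewrite e mulr_sumr; apply: eq_bigr => j _; rewrite IH; last 2 first.
- rewrite size_drop; have := ltn_ord j; lia.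
- by move: aP; rewrite -{1}(cat_take_drop j.+1 a) all_cat => /andP[].
(* The exponent [size a - j.+1] is a truncated difference, so signs are compared through
   parities. *)
rewrite size_drop -signr_odd -[in RHS](signr_odd _ (size a)) -[in RHS](signr_odd _ j.+1).
rewrite oddB //.
rewrite invfM.
have -> : ((-1) ^+ (odd (size a) (+) odd j.+1) : rat) =
    (-1) ^+ odd (size a) * (-1) ^+ odd j.+1.
  by rewrite signr_addb.
ring.
Qed.

Lemma pi_comp_take g j : (j <= size g)%N ->
  pi_comp (take j g) = (\prod_(0 <= i < j) sumn (take i.+1 g))%N.
Proof.
elim: j => [|j IH] jg; first by rewrite take0 big_geq // /pi_comp big_ord0.
by rewrite pi_comp_takeS // big_nat_recr //= IH // ltnW.
Qed.

Lemma pi_comp_rev_drop g j : (j <= size g)%N ->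
  pi_comp (rev (drop j g)) = (\prod_(j <= i < size g) sumn (drop i g))%N.
Proof.
move=> jg; rewrite -(subKn jg); move: (size g - j)%N (leq_subr j (size g)) => k.
elim: k => [|k IH] kg.
  by rewrite subn0 drop_size big_geq // /pi_comp big_ord0.
rewrite pi_comp_rev_dropS; last by lia.
rewrite big_ltn; last by lia.
by rewrite (_ : (size g - k.+1).+1 = size g - k)%N ?IH 1?mulnC; lia.
Qed.

(** Split off the first block of [rev g]: the weight [b_1] cancels the last factor of its [pi_comp],
    and [sum_sign_psi_coef] evaluates the rest. The last entry of that block, at position [j] of
    [g], becomes the center. *)
Lemma MaxOne_rev_psiE g : all (leq 1) g -> g != [::] ->
  MaxOne (psi (compo (rev g))) = MaxOne_rev_psi g.
Proof.
move=> gP g0; have aP : all (leq 1) (rev g) by rewrite all_rev.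
have [n an] : exists n, sumn (rev g) = n.+1.
  rewrite sumn_rev; case: (g) g0 gP => // -[//|x] a' _ _; by exists (x + sumn a')%N.
rewrite (@MaxOne_comps _ n); last 2 first.
- split; first exact: psi_inv.
  exists n.+1 => m; rewrite psiE; case: asboolP => // /refines_sumn + _.
  by rewrite compoK // an /mdeg /mcomp /= => ->.
- move=> m; rewrite psiE; case: asboolP => // /refines_sumn + _.
  by rewrite compoK // an /mdeg /mcomp /= => ->.
transitivity (\sum_(b <- comps n.+1) (head 0%N b)%:R * (-1) ^+ (size (behead b)) *
    psi_coef (rev g) b).
  rewrite big_seq [RHS]big_seq; apply: eq_bigr => b; rewrite mem_comps => /andP[bP _].
  by rewrite psi_compoE // size_behead.
rewrite (sum_psi_coef (fun k => k%:R) (fun b => (-1) ^+ size b) aP an).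
rewrite /MaxOne_rev_psi size_rev (reindex_inj rev_ord_inj) /=.
apply: eq_bigr => j _; have jl := ltn_ord j; set l := size g in jl *.
have sj : (l - j.+1 < size (rev g))%N by rewrite size_rev -/l; lia.
have dP : all (leq 1) (drop (l - j.+1).+1 (rev g)).
  by move: aP; rewrite -{1}(cat_take_drop (l - j.+1).+1 (rev g)) all_cat => /andP[].
rewrite sum_sign_psi_coef // pi_comp_takeS //.
have s0 : ((sumn (take (l - j.+1).+1 (rev g)))%:R : rat) != 0.
  by rewrite pnatr_eq0 -lt0n sumn_take_gt0.
rewrite natrM [X in X * _](_ : _ = (pi_comp (take (l - j.+1) (rev g)))%:R^-1); last first.
  by rewrite invfM mulrCA mulfV // mulr1.
rewrite size_drop size_rev -/l subnSK //.
rewrite drop_rev revK take_rev -/l !subKn ?(ltnW jl) //.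
rewrite mulrCA -invfM -natrM; congr (_ / _%:R).
rewrite mulnC pi_comp_take ?(ltnW jl) // pi_comp_rev_drop //.
rewrite -(big_mkord (fun i => i != j :> nat) (fun i => power_sum_hook g j i)).
rewrite [RHS](big_cat_nat _ (n := j)) //=; last exact: ltnW.
rewrite [X in _ = (_ * X)%N]big_ltn_cond //= eqxx /=; congr muln.
  rewrite [RHS]big_mkcond /=; apply: eq_big_nat => i /andP[_ ij].
  by rewrite /power_sum_hook ij ltn_eqF.
rewrite [RHS]big_mkcond /=; apply: eq_big_nat => i /andP[ij _].
by rewrite /power_sum_hook gtn_eqF //= ltnNge ltnW.
Qed.

(* A third computation of the coefficients of [psi], splitting off the last part;
   both compositions are read from right to left. *)
Fixpoint top_coef (a b : seq nat) : rat :=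
  match a, b with
  | [::], [::] => 1
  | x :: a', y :: b' =>
      if (x <= y)%N then y%:R^-1 * top_coef a' (cons_pos (y - x) b') else 0
  | _, _ => 0
  end.

Lemma top_coef_neq0 a b : top_coef a b != 0 -> refinesb a b.
Proof.
elim: a b => [|x a IH] [|y b] //=; rewrite ?eqxx //; case: leqP; rewrite ?eqxx //= => _.
by rewrite mulf_eq0 negb_or => /andP[_ /IH].
Qed.

(** The current [y] is the sum of the unread entries of its block, which is the last factor of
    [pi_comp] for these entries in their original order. *)
Lemma top_coef_blocks a b g : all (leq 1) a -> all (leq 1) b -> is_blocks a b g ->
  top_coef a b = \prod_(h <- g) (pi_comp (rev h))%:R^-1.
Proof.
elim: a b g => [|k a IH] b g aP bP [ga gb].
  move: bP; rewrite -gb; case: g ga {gb} => [|h g] /=; first by rewrite big_nil.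
  by case: h.
case: g ga gb => [//|h g] /= ga gb; move: bP; rewrite -gb /= => /andP[h0 bP].
case: h ga gb h0 => [//|y h] /= [ek ga] gb _; subst y.
have aP' : all (leq 1) a by case/andP: aP.
rewrite leq_addr addKn big_cons rev_cons pi_comp_rcons -rev_cons sumn_rev /= natrM invfM.
rewrite [X in _ = X * _]mulrC -mulrA; congr *%R; rewrite /cons_pos; case: eqP => [h0|/eqP h0].
  have hnil : h = [::].
    by apply: sumn_pos_eq0 h0; move: aP'; rewrite -ga all_cat => /andP[].
  rewrite (IH _ g) // ?hnil /pi_comp /= ?big_ord0 ?invr1 ?mul1r //.
  by split=> //; rewrite -ga hnil.
rewrite (IH _ (h :: g)) ?big_cons //= lt0n h0 //.
Qed.

Lemma is_blocks_rev a b g : is_blocks a b g ->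
  is_blocks (rev a) (rev b) (rev (map rev g)).
Proof.
move=> [<- <-]; split; last first.
  by rewrite map_rev -map_comp; congr rev; apply: eq_map => h /=; rewrite sumn_rev.
by elim: g => //= h g IH; rewrite rev_cons flatten_rcons IH rev_cat.
Qed.

Lemma psi_compo_rev a b : all (leq 1) a -> all (leq 1) b ->
  psi (compo (rev a)) (mon (compo (rev b))) = top_coef a b.
Proof.
move=> aP bP; have [[g gP]|no] := pselect (exists g, is_blocks a b g).
  rewrite (psi_compo _ _ (is_blocks_rev gP)) ?all_rev // (top_coef_blocks aP bP gP).
  rewrite (perm_big (map rev g)) ?big_map //; by rewrite perm_rev.
rewrite psi_compo0 ?all_rev // => [|g /is_blocks_rev]; last first.
  by rewrite !revK => gP; case: no; eexists; exact: gP.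
by apply/esym/eqP/negPn/negP => /top_coef_neq0/refinesbP h; apply/no/h.
Qed.

(** * Expansion of [K P] in power sums *)

Section Pointed.
Variables (d : Order.disp_t) (P : finPOrderType d).

(* Sequences [x_1, x_2, ...] such that the blocks [A_i :&: upper x_i] exhaust [A],
   where [A_i] is [A] without the earlier blocks. They encode the order-preserving
   surjections whose fibers have a least element, the top fiber coming first. *)
Fixpoint pointed_rec (k : nat) (A : {set P}) : seq (seq P) :=
  if A == set0 then [:: [::]] else
  if k is k'.+1 then
    [seq x :: s | x <- enum A, s <- pointed_rec k' (A :\: upper x)]
  else [::].

Definition pointed (A : {set P}) : seq (seq P) := pointed_rec #|A| A.

Lemma card_setD_upper (A : {set P}) x : x \in A -> (#|A :\: upper x| < #|A|)%N.
Proof.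
move=> xA; apply: proper_card; apply/properP; split; first exact: subsetDl.
by exists x => //; rewrite !inE lexx.
Qed.

Lemma pointed_recE k (A : {set P}) : (#|A| <= k)%N -> pointed_rec k A = pointed A.
Proof.
suff H m : forall k k' (A : {set P}), (#|A| <= m)%N -> (#|A| <= k)%N -> (#|A| <= k')%N ->
    pointed_rec k A = pointed_rec k' A by move=> Ak; apply: (H #|A|).
elim: m => [|m IH] {}k k' {}A Am Ak Ak'.
  move: Am; rewrite leqn0 cards_eq0 => /eqP->.
  by case: k {Ak}; case: k' {Ak'} => *; rewrite /= eqxx.
have [->|A0] := eqVneq A set0; first by case: k {Ak}; case: k' {Ak'} => *; rewrite /= eqxx.
have cA : (0 < #|A|)%N by rewrite card_gt0.
case: k Ak => [|k] Ak; first by rewrite leqNgt cA in Ak.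
case: k' Ak' => [|k'] Ak'; first by rewrite leqNgt cA in Ak'.
rewrite /= (negPf A0); congr (flatten _); apply/eq_in_map => x.
rewrite mem_enum => /card_setD_upper lt.
by rewrite (IH k k') // -ltnS; apply: leq_trans lt _.
Qed.

Lemma pointed0 : pointed set0 = [:: [::]].
Proof. by rewrite /pointed cards0 /= eqxx. Qed.

Lemma big_pointed (R : Type) (idx : R) (op : Monoid.com_law idx)
    (A : {set P}) (Q : pred (seq P)) (G : seq P -> R) : A != set0 ->
  \big[op/idx]_(s <- pointed A | Q s) G s =
  \big[op/idx]_(x in A) \big[op/idx]_(s <- pointed (A :\: upper x) | Q (x :: s)) G (x :: s).
Proof.
move=> A0; rewrite {1}/pointed; case cA : #|A| => [|k].
  by move/eqP: cA; rewrite cards_eq0 (negPf A0).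
rewrite /= (negPf A0) big_mkcond big_allpairs_dep big_enum /=.
apply: eq_bigr => x xA; rewrite pointed_recE -?big_mkcond //.
by rewrite -ltnS -cA card_setD_upper.
Qed.

Lemma block_sizes_pos (A : {set P}) s : s \in pointed A -> all (leq 1) (block_sizes A s).
Proof.
suff H k : (#|A| <= k)%N -> s \in pointed_rec k A -> all (leq 1) (block_sizes A s).
  by apply: H.
elim: k A s => [|k IH] A s Ak /=; case: eqP => [->|/eqP A0]; rewrite ?inE; try by move=> /eqP->.
  by [].
move=> /allpairsPdep[x [t [xA tA ->]]] /=; rewrite mem_enum in xA.
apply/andP; split; first by rewrite card_gt0; apply/set0Pn; exists x; rewrite !inE xA lexx.
by apply: IH tA; rewrite -ltnS; apply: leq_trans (card_setD_upper xA) Ak.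
Qed.

Lemma minimalsD (A : {set P}) x : x \in minimals A ->
  minimals (A :\: upper x) = minimals A :\ x.
Proof.
move=> xM; have xA := subsetP (minimals_sub A) x xM.
apply/setP => z; rewrite !inE; apply/andP/and3P => [[/andP[xz zA] /forallP h]|[zx zA /forallP h]].
  split=> //; first by apply: contra xz => /eqP->.
  apply/forallP => y; apply/implyP => yA; apply/negP => yz.
  have := h y; rewrite !inE yA yz /= andbT implybF negbK => xy.
  by rewrite (le_trans xy (ltW yz)) in xz.
rewrite zA andbT; split.
  apply/negP => xz; have := h x; rewrite xA /= lt_neqAle xz andbT negbK => /eqP e.
  by rewrite e eqxx in zx.
by apply/forallP => y; apply/implyP; rewrite !inE => /andP[_ yA]; have := h y; rewrite yA.
Qed.

Lemma minimalsD_sub (A : {set P}) x : x \in A -> x \notin minimals A ->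
  minimals A \subset minimals (A :\: upper x).
Proof.
move=> xA xM; apply/subsetP => z zM; have zA := subsetP (minimals_sub A) z zM.
rewrite !inE zA andbT; apply/andP; split.
  by apply: contra xM => xz; rewrite (minimals_eq zM xA xz).
apply/forallP => y; apply/implyP; rewrite !inE => /andP[_ yA].
by move: zM; rewrite inE => /andP[_ /forallP/(_ y)]; rewrite yA.
Qed.

Lemma minimals0 : minimals (set0 : {set P}) = set0.
Proof. by apply/eqP; rewrite -subset0 minimals_sub. Qed.

(** Removing [upper x] loses the single minimal element [x] if [x] is minimal, and none
    otherwise. *)
Lemma size_pointed (A : {set P}) s : s \in pointed A -> (#|minimals A| <= size s)%N.
Proof.
suff H k : (#|A| <= k)%N -> s \in pointed_rec k A -> (#|minimals A| <= size s)%N.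
  by apply: H.
elim: k A s => [|k IH] A s Ak /=; case: eqP => [->|/eqP A0]; rewrite ?inE //.
- by rewrite minimals0 cards0.
- by rewrite minimals0 cards0.
move=> /allpairsPdep[x [t [xA tA ->]]] /=; rewrite mem_enum in xA.
have {}IH : (#|minimals (A :\: upper x)| <= size t)%N.
  by apply: IH tA; rewrite -ltnS; apply: leq_trans (card_setD_upper xA) Ak.
have [xM|xM] := boolP (x \in minimals A).
  by rewrite (cardsD1 x) xM add1n ltnS -minimalsD.
by apply/leqW/(leq_trans _ IH)/subset_leq_card/minimalsD_sub.
Qed.

(* A pointed sequence of minimal length removes one minimal element per step. *)
Lemma big_pointed_short (G : seq P -> rat) (A : {set P}) :
  \sum_(s <- pointed A | size s == #|minimals A|) G s =
  \sum_(s <- orderings (minimals A)) G s.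
Proof.
have [k] := ubnP #|A|; elim: k A G => // k IH A G Ak.
have [A0|A0] := eqVneq A set0.
  by rewrite A0 minimals0 pointed0 orderings0 cards0 big_cons big_nil big_seq1 addr0.
have [x0 x0A] := set0Pn _ A0; have [y0 y0M _] := minimals_below x0A.
rewrite big_pointed // big_orderings; last by apply/set0Pn; exists y0.
rewrite (bigID (fun x => x \in minimals A)) /= [X in _ + X]big1 ?addr0.
  rewrite (eq_bigl (fun x => x \in minimals A)); last first.
    by move=> x; rewrite /= andb_idl // => /(subsetP (minimals_sub A)).
  apply: eq_bigr => x xM; have xA := subsetP (minimals_sub A) x xM.
  rewrite -minimalsD // -IH; last by have := card_setD_upper xA; lia.
  by apply: eq_bigl => s; rewrite [#|minimals A|](cardsD1 x) xM add1n eqSS minimalsD.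
(* A nonminimal first entry leaves all minimal elements to be removed, which makes the sequence too
   long. *)
move=> x /andP[xA xM]; rewrite big_seq_cond big1 // => s /andP[sA /eqP e].
have := leq_trans (subset_leq_card (minimalsD_sub xA xM)) (size_pointed sA).
by rewrite -e ltnn.
Qed.

Section Count.
Variable L : nat.

(** Order-preserving maps on [A] with fiber sizes [b], top fiber first; the fixed value [ord0] off
    [A] lets each be counted once. The codomain is inhabited even for [L = 0]. *)
Let S (A : {set P}) (b : seq nat) : {set {ffun P -> 'I_L.+1}} :=
  [set t : {ffun P -> 'I_L.+1} |
    [&& [forall x in A, forall y in A, (x <= y)%O ==> (t x <= t y)%N],
        [forall i : 'I_L.+1, #|[set x in A | t x == i]| == nth 0%N (rev b) i]
      & [forall x, (x \notin A) ==> (t x == ord0)]]].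

Let SP (A : {set P}) b (t : {ffun P -> 'I_L.+1}) : reflect
  [/\ forall x y, x \in A -> y \in A -> (x <= y)%O -> (t x <= t y)%N,
      forall i : 'I_L.+1, #|[set x in A | t x == i]| = nth 0%N (rev b) i
    & forall x, x \notin A -> t x = ord0] (t \in S A b).
Proof.
rewrite inE; apply: (iffP and3P) => [[/forallP h1 /forallP h2 /forallP h3]|[h1 h2 h3]].
  split=> [x y xA yA xy|i|x xA]; last by have := h3 x; rewrite xA => /eqP.
    by have := h1 x; rewrite xA => /forallP/(_ y); rewrite yA xy.
  exact/eqP.
split; apply/forallP => x; last by apply/implyP => /h3->.
  apply/implyP => xA; apply/forallP => y; apply/implyP => yA; apply/implyP; exact: h1.
by apply/eqP.
Qed.

Let S_cons_pos (A : {set P}) x b : S A (cons_pos x b) = S A (x :: b).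
Proof.
rewrite /cons_pos; case: eqP => // ->; apply/setP => t; rewrite !inE; congr [&& _, _ & _].
apply: eq_forallb => i; rewrite rev_cons nth_rcons size_rev.
by case: ltnP => // h; rewrite nth_default ?size_rev // if_same.
Qed.

(** If [x] is in the top fiber, so is all of [A] above it. Removing this filter ([res]) and putting
    it back ([ext]) match these maps with the maps on the rest whose top fiber is smaller by that
    amount. *)
Let S_peel (A : {set P}) b0 b x : (size b <= L)%N -> x \in A ->
  #|[set t in S A (b0 :: b) | t x == size b :> nat]| =
  (if #|A :&: upper x| <= b0 then #|S (A :\: upper x) ((b0 - #|A :&: upper x|) :: b)|
   else 0)%N.
Proof.
move=> bL xA; pose top : 'I_L.+1 := Ordinal (bL : (size b < L.+1)%N).
set U := A :&: upper x.
have nthE c i : nth 0%N (rev (c :: b)) i =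
    (if i == size b then c else nth 0%N (rev b) i).
  rewrite rev_cons nth_rcons size_rev; case: ltngtP => // h.
  by rewrite nth_default // size_rev ltnW.
have cardE (t : {ffun P -> 'I_L.+1}) i : (forall y, y \in U -> t y = top) ->
    #|[set y in A | t y == i]| =
    ((i == top) * #|U| + #|[set y in A :\: upper x | t y == i]|)%N.
  move=> tU; rewrite -[LHS](cardsID (upper x)); congr addn; last first.
    by apply: eq_card => y; rewrite !inE andbA.
  case: eqP => [->|/eqP ni]; rewrite ?mul1n ?mul0n.
    apply: eq_card => y; rewrite !inE andbAC andb_idr // => yU.
    by rewrite tU // !inE.
  apply/eqP; rewrite cards_eq0; apply/eqP/setP => y; rewrite !inE andbAC.
  apply/negP => /andP[yU /eqP e]; case/eqP: ni.
  by rewrite -e tU // !inE.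
have topU t : t \in [set t in S A (b0 :: b) | t x == size b :> nat] ->
    forall y, y \in U -> t y = top.
  rewrite inE => /andP[/SP[h1 h2 _] /eqP tx] y; rewrite !inE => /andP[yA xy].
  apply/val_inj/eqP; rewrite /= eqn_leq -{2}tx h1 // andbT leqNgt; apply/negP => lt.
  have := h2 (t y); rewrite nthE gtn_eqF // nth_default ?size_rev ?(ltnW lt) //.
  by move/eqP; rewrite cards_eq0 => /eqP/setP/(_ y); rewrite !inE yA eqxx.
case: leqP => [Ub|bU]; last first.
  apply/eqP; rewrite cards_eq0; apply/eqP/setP => t; rewrite [RHS]inE; apply/negP => tS.
  have tU := topU t tS; move: tS; rewrite inE => /andP[/SP[_ h2 _] _].
  have := h2 top; rewrite cardE // nthE eqxx eqxx mul1n => e.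
  by move: bU; rewrite -e ltnNge leq_addr.
pose ext (t : {ffun P -> 'I_L.+1}) : {ffun P -> 'I_L.+1} :=
  [ffun y => if y \in U then top else t y].
pose res (t : {ffun P -> 'I_L.+1}) : {ffun P -> 'I_L.+1} :=
  [ffun y => if y \in upper x then ord0 else t y].
have -> : [set t in S A (b0 :: b) | t x == size b :> nat] =
    ext @: S (A :\: upper x) ((b0 - #|U|)%N :: b).
  apply/setP => t; apply/idP/imsetP => [tS|[t' /SP[h1 h2 h3] ->]].
    have tU := topU t tS; move: tS; rewrite inE => /andP[/SP[h1 h2 h3] tx].
    exists (res t); last first.
      apply/ffunP => y; rewrite !ffunE; case: ifP => [/tU->//|yU].
      case: ifP => // xy; rewrite h3 //; apply: contraFN yU => yA.
      by rewrite !inE yA; move: xy; rewrite inE.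
    apply/SP; split=> [y z|i|y].
    - rewrite !inE !ffunE !inE => /andP[/negPf-> yA] /andP[/negPf-> zA]; exact: h1.
    - transitivity #|[set y in A :\: upper x | t y == i]|.
        apply: eq_card => y; rewrite !inE ffunE !inE.
        by case: (x <= y)%O.
      have := h2 i; rewrite cardE // !nthE -(inj_eq val_inj) /=.
      by case: eqP => _; rewrite ?mul1n ?mul0n ?add0n => <- //; rewrite addKn.
    by rewrite !inE ffunE inE; case: (x <= y)%O => //= /h3.
  have xU : x \in U by rewrite !inE xA lexx.
  have inD w : w \in A -> (w \in U) = false -> w \in A :\: upper x.
    by rewrite !inE => -> /= ->.
  rewrite inE ffunE xU eqxx andbT; apply/SP; split=> [y z yA zA yz|i|y yA].
  - rewrite !ffunE; case: ifP => [yU|yU].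
      rewrite ifT // !inE zA /=; move: yU; rewrite !inE => /andP[_ xy].
      exact: le_trans xy yz.
    case: ifP => [_|zU].
      rewrite /= leqNgt; apply/negP => lt.
      have yD := inD y yA yU.
      have := h2 (t' y); rewrite nthE gtn_eqF // nth_default ?size_rev ?(ltnW lt) //.
      by move/eqP; rewrite cards_eq0 => /eqP/setP/(_ y); rewrite inE yD inE eqxx.
    by apply: h1; rewrite ?inD.
  - rewrite cardE => [|y yU]; last by rewrite ffunE yU.
    transitivity ((i == top) * #|U| + #|[set y in A :\: upper x | t' y == i]|)%N.
      congr addn; apply: eq_card => y; rewrite !inE ffunE !inE.
      by case: (x <= y)%O; rewrite ?andbF.
    rewrite h2 !nthE -(inj_eq val_inj) /=.
    by case: eqP => _; rewrite ?mul1n ?mul0n ?add0n // subnKC.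
  by rewrite ffunE !inE (negPf yA) /= h3 // !inE (negPf yA) andbF.
apply: card_in_imset => t t' /SP[_ _ h] /SP[_ _ h'] /ffunP e; apply/ffunP => y.
have := e y; rewrite !ffunE; case: ifP => // yU _.
by rewrite h ?h' //; move: yU; rewrite !inE => /andP[-> ->].
Qed.

(** Counts pairs of a map and an element [x] of its top fiber, which has [b0] elements. *)
Let S_step (A : {set P}) b0 b : (size b <= L)%N ->
  (#|S A (b0 :: b)| * b0 = \sum_(x in A)
    if #|A :&: upper x| <= b0 then #|S (A :\: upper x) ((b0 - #|A :&: upper x|) :: b)|
    else 0)%N.
Proof.
move=> bL; pose top : 'I_L.+1 := Ordinal (bL : (size b < L.+1)%N).
under [RHS]eq_bigr => x xA do rewrite -S_peel // -sum1dep_card big_mkcondr /=.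
rewrite exchange_big /= -sum1_card big_distrl /=; apply: eq_bigr => t /SP[_ h _].
rewrite mul1n -big_mkcondr sum1dep_card; have := h top.
rewrite rev_cons nth_rcons size_rev ltnn eqxx => <-; apply: eq_card => x.
by rewrite !inE -(inj_eq val_inj).
Qed.

(** [S_step] divided by [b0] is the recursion defining [top_coef], the peeled filter being the first
    block. *)
Let count_pointed (A : {set P}) b : all (leq 1) b -> (size b <= L.+1)%N ->
  #|S A b|%:R = \sum_(s <- pointed A) top_coef (block_sizes A s) b.
Proof.
have [k] := ubnP #|A|; elim: k A b => // k IH A b Ak bP bL.
have [->|A0] := eqVneq A set0.
  rewrite pointed0 big_seq1 /=; case: b bP bL => [|b0 b] /= bP bL.
    rewrite (_ : S set0 [::] = [set [ffun=> ord0]]) ?cards1 //.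
    apply/setP => t; apply/SP/idP => [[_ _ h]|].
      by rewrite inE; apply/eqP/ffunP => x; rewrite ffunE h // inE.
    rewrite inE => /eqP->; split=> [x y|i|x _]; rewrite ?ffunE ?inE //.
    rewrite nth_default //; apply/eqP; rewrite cards_eq0; apply/eqP/setP => x.
    by rewrite !inE.
  rewrite (_ : S set0 (b0 :: b) = set0) ?cards0 //; apply/setP => t; rewrite [RHS]inE.
  apply/negP => /SP[_ /(_ (Ordinal bL)) + _].
  rewrite rev_cons nth_rcons size_rev ltnn eqxx => e.
  move: bP => /andP[]; rewrite -e card_gt0 => /set0Pn[x]; by rewrite !inE.
rewrite big_pointed //; case: b bP bL => [|b0 b] /= bP bL.
  rewrite [RHS]big1 => [|x _]; last by rewrite big1.
  rewrite (_ : S A [::] = set0) ?cards0 //; apply/setP => t; rewrite [RHS]inE.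
  apply/negP => /SP[_ h _]; have [x xA] := set0Pn _ A0; have := h (t x).
  rewrite nth_default // => /eqP; rewrite cards_eq0 => /eqP/setP/(_ x).
  by rewrite !inE xA eqxx.
have /andP[b00 bP'] := bP.
have nb0 : (b0%:R : rat) != 0 by rewrite pnatr_eq0 -lt0n.
apply: (mulIf nb0); rewrite -natrM S_step // natr_sum mulr_suml.
apply: eq_bigr => x xA; case: leqP => Ub; last by rewrite big1 ?mul0r.
rewrite -mulr_sumr mulrAC mulVf // mul1r -S_cons_pos IH //.
- by have := card_setD_upper xA; lia.
- by rewrite /cons_pos; case: eqP => //= /eqP; rewrite -lt0n => ->.
by rewrite /cons_pos; case: eqP => //= _; exact: ltnW.
Qed.

Let K_count (b : composition) : size b = L ->
  K P (mon b) = #|S [set: P] (rev b)|%:R.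
Proof.
move=> bL; rewrite KE.
pose C := [set t : {ffun P -> nat} | order_preserving t /\ weight t = mon b]%classic.
rewrite -/C.
pose h (t : {ffun P -> 'I_L.+1}) : {ffun P -> nat} := [ffun x => nat_of_ord (t x)].
have weightP (t : {ffun P -> nat}) :
    weight t = mon b <-> forall i, #|[set x | t x == i]| = nth 0%N b i.
  split=> [e i|e]; first by rewrite -weightE e monE.
  by apply/fsfunP => i; rewrite weightE e monE.
rewrite (@reindex_fsbig _ _ _ _ _ h [set` enum (S [set: P] (rev b))]%classic C); last first.
  split.
  - move=> t /=; rewrite mem_enum => /SP[h1 h2 _]; split.
      by move=> x y xy; rewrite !ffunE h1 // inE.
    apply/weightP => i; have [iL|iL] := ltnP i L.+1.
      have := h2 (Ordinal iL); rewrite revK /= => <-; apply: eq_card => x.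
      by rewrite !inE ffunE.
    rewrite nth_default ?bL ?(ltnW iL) //; apply/eqP; rewrite cards_eq0.
    apply/eqP/setP => x; rewrite !inE ffunE; apply/negP => /eqP e.
    by have := ltn_ord (t x); rewrite e ltnNge iL.
  - move=> t u _ _ /ffunP e; apply/ffunP => x; apply: val_inj.
    by have := e x; rewrite !ffunE.
  move=> t [ot /weightP tw].
  have tL x : (t x < L.+1)%N.
    rewrite ltnS leqNgt; apply/negP => lt; have := tw (t x).
    rewrite nth_default ?bL ?(ltnW lt) // => /eqP; rewrite cards_eq0 => /eqP/setP/(_ x).
    by rewrite !inE eqxx.
  exists [ffun x => Ordinal (tL x)]; last by apply/ffunP => x; rewrite !ffunE.
  rewrite /= mem_enum; apply/SP; split=> [x y _ _ xy|i|x]; rewrite ?inE //.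
    by rewrite !ffunE /=; apply: ot.
  by rewrite revK -tw; apply: eq_card => x; rewrite !inE ffunE -(inj_eq val_inj).
rewrite -fsbig_seq ?enum_uniq //= big_const_seq count_predT -cardE.
by rewrite iter_addr_0.
Qed.

Lemma K_mon_size (b : composition) : size b = L -> K P (mon b) =
  \sum_(s <- pointed [set: P]) top_coef (block_sizes [set: P] s) (rev b).
Proof.
move=> bL; rewrite K_count // count_pointed //; first by rewrite all_rev partsP.
by rewrite size_rev bL.
Qed.

End Count.

Lemma K_psi : K P = \sum_(s <- pointed [set: P])
  psi (compo (rev (block_sizes [set: P] s))).
Proof.
apply/funext => m; rewrite ps_sumE.
have Km : K P m = K P (mon (mcomp m)).
  by apply: (proj1 (K_quasisymmetric P)); rewrite exponents_mon.
rewrite Km (K_mon_size (erefl _)) big_seq [RHS]big_seq; apply: eq_bigr => s sP.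
rewrite -psi_compo_rev ?block_sizes_pos ?all_rev ?partsP // revK compo_parts.
by apply: psi_inv; rewrite exponents_mon.
Qed.

End Pointed.



(** * Terms of minimal length and the final comparison *)

Lemma psi_coord_count F (l : seq composition) : F = \sum_(a <- l) psi a ->
  finsupp (Defs.coord psi F) =i l /\
  (forall a, Defs.coord psi F a = (count_mem a l)%:R).
Proof.
move=> Fl; pose U := [fset a in l]%fset.
pose c : coefs := [fsfun a in U => (count_mem a l)%:R | 0].
have cE a : c a = (count_mem a l)%:R.
  rewrite fsfunE; case: ifP => // /negbT; rewrite in_fset /= => al.
  by rewrite (count_memPn al).
have cl : finsupp c =i l.
  by move=> a; rewrite mem_finsupp cE pnatr_eq0 -lt0n -has_count has_pred1.
rewrite (@psi_coordE _ c) //; rewrite /is_expansion Fl.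
rewrite -big_undup_iterop_count (perm_big (finsupp c)) /=; last first.
  by apply: uniq_perm; rewrite ?undup_uniq ?fset_uniq // => a; rewrite mem_undup cl.
by apply: eq_bigr => a _; rewrite cE scaler_nat.
Qed.

Lemma quasisymmetric_psi a : quasisymmetric (psi a).
Proof.
split; first exact: psi_inv.
exists (sumn a) => m; rewrite psiE; case: asboolP => // /refines_sumn e _.
by rewrite e.
Qed.

Lemma quasisymmetric_sum_psi (l : seq composition) (Q : pred composition) :
  quasisymmetric (\sum_(a <- l | Q a) psi a).
Proof.
apply: big_ind => [|F G [Fi [N FN]] [Gi [N' GN]]|a _]; last exact: quasisymmetric_psi.
  by split=> //; exists 0%N => m; rewrite eqxx.
split=> [m m' e|]; first by rewrite !ps_addE (Fi m m') // (Gi m m').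
exists (maxn N N') => m; rewrite ps_addE leq_max; apply: contraR.
rewrite negb_or => /andP[h h'].
have -> : F m = 0 by apply/eqP; apply: contraR h; apply: FN.
by have -> : G m = 0 by apply/eqP; apply: contraR h'; apply: GN.
Qed.

Lemma MaxOne_sum_psi (l : seq composition) (Q : pred composition) :
  MaxOne (\sum_(a <- l | Q a) psi a) = \sum_(a <- l | Q a) MaxOne (psi a).
Proof.
elim: l => [|a l IH]; last first.
  rewrite !big_cons; case: ifP => // _; rewrite -IH -[psi a]scale1r MaxOne_linear.
  - by rewrite scale1r mul1r.
  - exact: quasisymmetric_psi.
  exact: quasisymmetric_sum_psi.
rewrite !big_nil; have q0 : quasisymmetric 0.
  by split=> //; exists 0%N => m; rewrite eqxx.
have := MaxOne_linear 1 q0 q0; rewrite scale1r addr0 mul1r => /eqP.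
by rewrite -subr_eq subrr eq_sym => /eqP.
Qed.

(** The coefficients of [K P] are multiplicities in [l], so nothing cancels and the support is all
    of [l]; its least length is the number of minimal elements. *)
Lemma Ktilde_psi (d : Order.disp_t) (P : finPOrderType d) :
  let l := [seq compo (rev (block_sizes [set: P] s)) | s <- pointed [set: P]] in
  Ktilde P =
  \sum_(a <- l | size a == #|minimals [set: P]|) psi a.
Proof.
move=> l; have Kl : K P = \sum_(a <- l) psi a by rewrite K_psi big_map.
have [cl cE] := psi_coord_count Kl; rewrite /Ktilde; set c := Defs.coord psi (K P) in cl cE *.
have sizel s : s \in pointed [set: P] ->
    size (compo (rev (block_sizes [set: P] s))) = size s.
  move=> sP; rewrite compoK ?size_rev ?size_block_sizes //.
  by rewrite all_rev block_sizes_pos.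
have lge (a : composition) : a \in l -> (#|minimals [set: P]| <= size a)%N.
  by move=> /mapP[s sP ->]; rewrite sizel // size_pointed.
have [a0 a0l a0s] : exists2 a0 : composition, a0 \in l & size a0 = #|minimals [set: P]|.
  (* The bound is attained: the sequences of this length are as many as the orderings of the minimal
     elements, a positive factorial. *)
  have : has (fun s : seq P => size s == #|minimals [set: P]|) (pointed [set: P]).
    rewrite has_count -(ltr0n rat) -sum1_count natr_sum big_pointed_short.
    rewrite big_const_seq count_predT iter_addr_0 ltr0n size_permutations ?enum_uniq //.
    exact: fact_gt0.
  case/hasP=> s sP /eqP e; exists (compo (rev (block_sizes [set: P] s))).
    exact: map_f.
  by rewrite sizel.
rewrite -[RHS]big_undup_iterop_count (perm_big (undup l)) /=; last first.
  by apply: uniq_perm; rewrite ?undup_uniq ?fset_uniq // => a; rewrite mem_undup cl.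
rewrite big_seq_cond [RHS]big_seq_cond; apply: eq_big => [a|a _]; last first.
  by rewrite cE scaler_nat.
rewrite mem_undup; case: (boolP (a \in l)) => //= al; apply/allP/eqP => [h|e b].
  apply/eqP; rewrite eqn_leq lge // andbT -a0s; apply: h.
  by rewrite cl.
by rewrite cl e; apply: lge.
Qed.

Theorem theorem4p17 (d : Order.disp_t) (P : finPOrderType d)
    (hn : (1 <= #|P|)%N) :
  #|zigzag_labelings P|%:R = (#|P| - 1)`!%:R * MaxOne (Ktilde P).
Proof.
rewrite card_zigzag_MaxOne // Ktilde_psi MaxOne_sum_psi big_map.
congr *%R; rewrite -big_pointed_short big_seq_cond [RHS]big_seq_cond.
have blP s : s \in pointed [set: P] -> all (leq 1) (rev (block_sizes [set: P] s)).
  by rewrite all_rev; apply: block_sizes_pos.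
apply: eq_big => [s|s /andP[sP /eqP ss]].
  case: (boolP (s \in _)) => //= sP.
  by rewrite compoK ?blP // size_rev size_block_sizes.
rewrite MaxOne_rev_psiE ?block_sizes_pos // -size_eq0 size_block_sizes ss.
(* The list of block sizes is nonempty because a nonempty [P] has a minimal element. *)
have /card_gt0P[x _] := hn.
have [|y yM _] := @minimals_below _ P [set: P] x; first by rewrite inE.
by rewrite cards_eq0; apply/set0Pn; exists y.
Qed.
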